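(* With probability one there exists $n_0$ such that for every $n\ge n_0$ the function $\mathbb R^3\ni(\alpha',\mu'_\varepsilon,\theta')\mapsto Q_n(\mathbf Y_n;\alpha',\mu'_\varepsilon,\theta')$ has a unique global minimizer $(\hat\alpha_n,\hat\mu_{\varepsilon,n},\hat\theta_n)$, given by $$\hat\alpha_n=\frac{(n-1)\sum^{(s)}Y_{k-1}Y_k-\sum^{(s)}Y_k\sum^{(s)}Y_{k-1}}{D_n},\quad \hat\mu_{\varepsilon,n}=\frac{\sum^{(s)}Y_{k-1}^2\sum^{(s)}Y_k-\sum^{(s)}Y_{k-1}\sum^{(s)}Y_{k-1}Y_k}{D_n},\quad \hat\theta_n=Y_s-\hat\alpha_nY_{s-1}-\hat\mu_{\varepsilon,n},$$ where $\sum^{(s)}$ denotes $\sum_{k=1,k\ne s}^n$ and $D_n=(n-1)\sum^{(s)}Y_{k-1}^2-(\sum^{(s)}Y_{k-1})^2$. Moreover, for every $(\alpha,\mu_\varepsilon,\theta)\in(0,1)\times(0,\infty)\times\mathbb N$, almost surely $\hat\alpha_n\to\alpha$, $\hat\mu_{\varepsilon,n}\to\mu_\varepsilon$ and $\hat\theta_n\to Y_s-\alpha Y_{s-1}-\mu_\varepsilon$.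
   Context: INAR(1) with an innovational outlier: Let $\alpha\in(0,1)$. Let $(\varepsilon_k)_{k\in\mathbb N}$ be i.i.d. non-negative integer-valued random variables with $\mathbb E\varepsilon_1^2<\infty$ and $\mathbb P(\varepsilon_1\ne 0)>0$; write $\mu_\varepsilon=\mathbb E\varepsilon_1$. For each $k\in\mathbb N$ let $(\xi_{k,j})_{j\in\mathbb N}$ be i.i.d. Bernoulli random variables with mean $\alpha$, these sequences being mutually independent and independent of $(\varepsilon_k)$. Fix a known time $s\in\mathbb N$ and size $\theta\in\mathbb N$. Let $Y_0$ be a non-negative integer-valued random variable with $\mathbb E Y_0^2<\infty$, independent of all $\xi_{k,j},\varepsilon_k$, and set $Y_k=\sum_{j=1}^{Y_{k-1}}\xi_{k,j}+\varepsilon_k+\delta_{k,s}\theta$, $k\in\mathbb N$. Write $\mathbf Y_n=(Y_0,\dots,Y_n)$. For $n\ge s$, $$Q_n(\mathbf y_n;\alpha',\mu'_\varepsilon,\theta')=\sum_{\substack{k=1\\k\neq s}}^n(y_k-\alpha'y_{k-1}-\mu'_\varepsilon)^2+(y_s-\alpha'y_{s-1}-\mu'_\varepsilon-\theta')^2 .$$ *)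

(* Defs.v *)
From HB Require Import structures.
From mathcomp Require Import all_boot all_order all_algebra.
From mathcomp Require Import all_classical all_reals all_analysis.

Set Implicit Arguments.
Unset Strict Implicit.
Unset Printing Implicit Defensive.

Import Order.TTheory GRing.Theory Num.Theory.
Import numFieldNormedType.Exports.

Local Open Scope classical_set_scope.
Local Open Scope ring_scope.

(* Index type of the primitive random variables of the model:
   None              ~ Y_0
   Some (inl k)      ~ eps_{k+1}
   Some (inr (k,j))  ~ xi_{k+1, j+1}                                      *)
Definition inar_idx := option (nat + (nat * nat)).

Definition inar_family (T : Type) (Y0 : T -> nat) (eps : nat -> T -> nat)
  (xi : nat -> nat -> T -> nat) : inar_idx -> T -> nat :=
  fun i => match i with
           | None => Y0
           | Some (inl k) => eps k
           | Some (inr (k, j)) => xi k j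
           end.

Definition mutually_independent d (T : measurableType d) (R : realType)
  (P : probability T R) (I : eqType) (X : I -> T -> nat) : Prop :=
  forall (s : seq I) (A : I -> set nat), uniq s ->
    P (\bigcap_(i in [set i | i \in s]) (X i @^-1` A i)) =
    (\prod_(i <- s) P (X i @^-1` A i))%E.

(* The INAR(1) process with an innovational outlier of size theta at time s
   (0-based storage: eps k = eps_{k+1}, xi k j = xi_{k+1,j+1}):
   Y_0 = Y0,  Y_{k+1} = sum_{j < Y_k} xi_{k+1,j+1} + eps_{k+1} + [k+1 = s] theta. *)
Fixpoint inar_Y (T : Type) (s theta : nat) (Y0 : T -> nat) (eps : nat -> T -> nat)
  (xi : nat -> nat -> T -> nat) (k : nat) (w : T) : nat :=
  match k with
  | 0 => Y0 w
  | k'.+1 => (\sum_(j < inar_Y s theta Y0 eps xi k' w) xi k' j w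
              + eps k' w + (k'.+1 == s) * theta)%N
  end.

Section LSE.
Variable R : realType.

Definition sum_s (s n : nat) (f : nat -> R) : R :=
  \sum_(1 <= k < n.+1 | k != s) f k.

Definition Qn (s n : nat) (y : nat -> R) (a m t : R) : R :=
  sum_s s n (fun k => (y k - a * y k.-1 - m) ^+ 2)
  + (y s - a * y s.-1 - m - t) ^+ 2.

Definition Dn (s n : nat) (y : nat -> R) : R :=
  (n%:R - 1) * sum_s s n (fun k => y k.-1 ^+ 2) - (sum_s s n (fun k => y k.-1)) ^+ 2.

Definition alpha_hat (s n : nat) (y : nat -> R) : R :=
  ((n%:R - 1) * sum_s s n (fun k => y k.-1 * y k)
   - sum_s s n (fun k => y k) * sum_s s n (fun k => y k.-1)) / Dn s n y.

Definition mu_hat (s n : nat) (y : nat -> R) : R :=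
  (sum_s s n (fun k => y k.-1 ^+ 2) * sum_s s n (fun k => y k)
   - sum_s s n (fun k => y k.-1) * sum_s s n (fun k => y k.-1 * y k)) / Dn s n y.

Definition theta_hat (s n : nat) (y : nat -> R) : R :=
  y s - alpha_hat s n y * y s.-1 - mu_hat s n y.

End LSE.

(* Main.v *)
Require Import Defs.
From HB Require Import structures.
From mathcomp Require Import all_boot all_order all_algebra.
From mathcomp Require Import all_classical all_reals all_analysis.
From mathcomp Require Import measurable_realfun.
From mathcomp Require Import ring lra.
Import Order.TTheory GRing.Theory Num.Theory.
Import numFieldNormedType.Exports.
Local Open Scope classical_set_scope.
Local Open Scope ring_scope.

(* Let M_k = Y_{k+1} - alpha Y_k - mu - theta [k+1 = s]. The estimation errors are
   explicit: alpha_hat - alpha = (N sum Y M - sum Y sum M) / D_n with N = n - 1, so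
   it suffices that the averages of M_k and of Y_k M_k vanish, that sum Y = O(n) and
   that D_n grows at least like n^2.  M_k is centred given the past with conditional
   variance O(1 + Y_k), but only second moments of Y_k are bounded, so Y_k M_k need
   not be square integrable.  As E[Y_k^2] is bounded, almost surely Y_k is eventually
   below (3/2)^{log_2 k}; truncating there gives uncorrelated variables of variance
   O((3/2)^{log_2 k}), for which a dyadic chaining bound yields a strong law of large
   numbers.  Finally 4 D_n / N is at least the number of k <= n with Y_{k+1} <> Y_k,
   up to 3, and a state change has conditional probability bounded below. *)

(** Neither a stationary law nor an ergodic theorem is invoked, so the averages of Y and Y^2 are not
    known to converge. Hence D_n is only bounded from below, and sum Y is only bounded from above,
    by summing the recursion. The lower bound rests on D_n / N being the sum of squared deviations
    of the regressors from their mean: when two consecutive integer states differ, one of them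
    deviates by at least 1/2. Conditional expectations are never formed. All primitive variables
    take values in [nat], so conditioning on the past means splitting the space into countably many
    fibres, on each of which the past is a constant and the next transition keeps its law. This
    freezing replaces the tower property throughout. *)

Lemma preimage_fibers {T C : Type} (N : T -> C) (S : set C) :
  N @^-1` S = \bigcup_(c in S) (N @^-1` [set c]).
Proof. by apply/seteqP; split=> [w Sw|w [c Sc /= ->]//]; exists (N w). Qed.

Definition cylinder {T : Type} {I : eqType} (X : I -> T -> nat) (s : seq I)
    (A : I -> set nat) : set T :=
  \bigcap_(i in [set i | i \in s]) (X i @^-1` A i).

(** A pi-system generating the sigma-algebra of the variables indexed by [J]; [J] may be infinite,
    while each cylinder constrains finitely many coordinates. *)
Definition cylinders {T : Type} {I : eqType} (X : I -> T -> nat) (J : set I) :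
    set (set T) :=
  [set C | exists s A,
    [/\ uniq s, (forall i, i \in s -> J i) & C = cylinder X s A]].

(** * Independence of generated sigma-algebras *)

Section GeneratedIndependence.
Local Open Scope ereal_scope.
Context {d : measure_display} {T : measurableType d} {R : realType}.
Variable P : probability T R.

Lemma dynkin_indep (B : set T) : measurable B ->
  dynkin [set A | measurable A /\ P (A `&` B) = P A * P B].
Proof.
move=> mB; split=> /=.
- by rewrite setTI probability_setT mul1e.
- move=> A [mA AB]; split; first exact: measurableC.
  have -> : ~` A `&` B = B `\` (A `&` B).
    by rewrite setDE setCI setIUr setICr setU0 setIC.
  rewrite measureD//; [|exact: measurableI|by rewrite -ge0_fin_numE// fin_num_measure].
  have -> : B `&` (A `&` B) = A `&` B by rewrite setIA setIAC setIid setIC.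
  transitivity (P B - P A * P B); first by rewrite -AB.
  by rewrite probability_setC// muleBl ?mul1e// ?fin_num_measure//
    fin_num_adde_defr// fin_num_measure.
- move=> F tF mF; split; first by apply: bigcup_measurable => k _; exact: (mF k).1.
  rewrite setI_bigcupl !measure_bigcup//=.
  + rewrite -(fineK (fin_num_measure P B mB)) muleC -nneseriesZl//.
    by apply: eq_eseriesr => i _; rewrite (mF i).2 fineK ?fin_num_measure// muleC.
  + by move=> i _; exact: (mF i).1.
  + by move=> i _; apply: measurableI => //; exact: (mF i).1.
  + exact: trivIset_setIr.
Qed.

Context {I : eqType}.
Variable X : I -> T -> nat.
Hypothesis mX : forall i m, measurable (X i @^-1` [set m]).

Lemma measurable_preimage_nat i (S : set nat) : measurable (X i @^-1` S).
Proof.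
rewrite (preimage_fibers (X i) S); apply: bigcup_measurable => m _; exact: mX.
Qed.

Lemma measurable_cylinder s A : measurable (cylinder X s A).
Proof.
apply: fin_bigcap_measurable; first exact: finite_seq.
by move=> i _; exact: measurable_preimage_nat.
Qed.

Lemma setI_closed_cylinders J : setI_closed (cylinders X J).
Proof.
move=> _ _ [s [A [us sJ ->]]] [t [B [ut tJ ->]]].
(* The implications make a constraint vacuous at the indices that its cylinder does not mention. *)
pose C i := [set n | (i \in s -> A i n) /\ (i \in t -> B i n)].
exists (undup (s ++ t)), C; split; first exact: undup_uniq.
  by move=> i; rewrite mem_undup mem_cat => /orP[/sJ|/tJ].
apply/seteqP; split=> [w [sw tw] i /= _|w Cw].
  by split=> [/sw|/tw].
by split=> i /= ij; have [] := Cw i; rewrite /= ?mem_undup ?mem_cat ?ij ?orbT//; auto.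
Qed.

Hypothesis indX : mutually_independent P X.

(** As the index sets are disjoint, the concatenated list has no repetition, so mutual independence
    applies to it and the product splits. *)
Lemma indep_cylinders (J K : set I) C D : J `&` K = set0 ->
  cylinders X J C -> cylinders X K D -> P (C `&` D) = P C * P D.
Proof.
move=> JK [s [A [us sJ ->]]] [t [B [ut tK ->]]].
have st i : i \in s -> i \in t -> False.
  by move=> /sJ ? /tK ?; suff : set0 i by []; rewrite -JK.
pose E i := if i \in s then A i else B i.
have -> : cylinder X s A `&` cylinder X t B = cylinder X (s ++ t) E.
  apply/seteqP; split=> [w [sw tw] i /=|w Ew].
    rewrite mem_cat /E; case: ifPn => [+ _|_ /= it]; first exact: sw.
    exact: tw.
  split=> i /= ij; have := Ew i; rewrite /= mem_cat /E ij ?orbT/=; first exact.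
  by case: ifPn => [/st//|_]; exact.
rewrite indX; last first.
  rewrite cat_uniq us ut andbT; apply/hasPn => i it.
  by apply/negP => /st.
rewrite big_cat/= !indX//; congr (_ * _); apply: eq_big_seq => i it.
  by rewrite /E it.
by rewrite /E; case: ifPn => // /st.
Qed.

Lemma sub_sigma_cylinders_measurable J : <<s cylinders X J >> `<=` measurable.
Proof.
apply: smallest_sub; first exact: sigma_algebra_measurable.
by move=> _ [s [A [_ _ ->]]]; exact: measurable_cylinder.
Qed.

(** The pi-lambda argument is used once per factor: first a cylinder over [J] is fixed and the other
    event ranges over the sigma-algebra of [K], then that event is fixed. *)
Lemma indep_sigma_cylinders (J K : set I) A B : J `&` K = set0 ->
  <<s cylinders X J >> A -> <<s cylinders X K >> B -> P (A `&` B) = P A * P B.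
Proof.
move=> JK sA sB.
have sub L (S : set T) : measurable S ->
    (forall C, cylinders X L C -> P (C `&` S) = P C * P S) ->
    forall C, <<s cylinders X L >> C -> P (C `&` S) = P C * P S.
  move=> mS h C sC.
  have /dynkin_lambda_system lam := dynkin_indep S mS.
  suff : <<s cylinders X L >> `<=` [set A | measurable A /\ P (A `&` S) = P A * P S].
    by move=> /(_ C sC)[].
  apply: lambda_system_subset => //; first exact: setI_closed_cylinders.
  move=> D cD; split; last exact: h.
  by apply: (@sub_sigma_cylinders_measurable L); exact: sub_sigma_algebra.
apply: (sub J) => //; first exact: sub_sigma_cylinders_measurable sB.
move=> C cC; rewrite setIC muleC; apply: (sub K) => //.
  by apply: (@sub_sigma_cylinders_measurable J); exact: sub_sigma_algebra.
by move=> D cD; rewrite setIC muleC; exact: indep_cylinders cC cD.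
Qed.

End GeneratedIndependence.

(** * Measurability of functions with countably many values *)

Section DiscreteFunctions.
Context {T : Type}.

(** Measurability of a discrete function with no measurable structure on its codomain; [F] is a
    plain set of sets, so that the notion serves both the ambient sigma-algebra and the generated
    ones. *)
Definition fiber_in (F : set (set T)) {C : Type} (N : T -> C) : Prop :=
  forall c, F (N @^-1` [set c]).

Variable G : set (set T).
Local Notation F := <<s G >>.

Lemma sigma_bigcup_count (C : countType) (D : set C) (A : C -> set T) :
  (forall c, F (A c)) -> F (\bigcup_(c in D) A c).
Proof.
move=> FA.
(* The union is reindexed by [nat] through [unpickle]; numbers that encode no element of [D]
   contribute [set0]. *)
rewrite (_ : \bigcup_(c in D) A c =
    \bigcup_n (if @unpickle C n is Some c then
                 if c \in D then A c else set0 else set0)); last first.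
  apply/seteqP; split=> [w [c Dc Aw]|w [n _]].
    by exists (pickle c) => //; rewrite pickleK mem_set.
  by case: unpickle => // c; case: ifPn => // /set_mem Dc; exists c.
apply: sigma_algebra_bigcup => n; case: unpickle => [c|]; last exact: sigma_algebra0.
by case: ifP => // _; exact: sigma_algebra0.
Qed.

Lemma sigma_setC (A : set T) : F A -> F (~` A).
Proof. by rewrite -setTD; exact: sigma_algebraCD. Qed.

Lemma sigma_setI (A B : set T) : F A -> F B -> F (A `&` B).
Proof.
move=> FA FB; rewrite -(setCK (A `&` B)) setCI -bigcup2E.
apply: sigma_setC; apply: sigma_algebra_bigcup => -[|[|n]] /=; try exact: sigma_setC.
exact: sigma_algebra0.
Qed.

Lemma fiber_in_preimage {C : countType} (N : T -> C) (S : set C) :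
  fiber_in F N -> F (N @^-1` S).
Proof.
move=> FN; rewrite preimage_fibers; exact: sigma_bigcup_count.
Qed.

Lemma fiber_in_comp {C D : countType} (N : T -> C) (h : C -> D) :
  fiber_in F N -> fiber_in F (h \o N).
Proof. by move=> FN c; rewrite comp_preimage; exact: fiber_in_preimage. Qed.

(** Here the function applied is itself selected at random by [N], as when the random state
    determines how many thinning variables are summed. *)
Lemma fiber_in_bind {C D : countType} (N : T -> C) (V : C -> T -> D) :
  fiber_in F N -> (forall c, fiber_in F (V c)) ->
  fiber_in F (fun w => V (N w) w).
Proof.
move=> FN FV e.
rewrite (_ : _ @^-1` _ = \bigcup_(c in [set: C]) ((N @^-1` [set c]) `&` (V c @^-1` [set e]))).
  by apply: sigma_bigcup_count => c; apply: sigma_setI; [exact: FN|exact: FV].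
apply/seteqP; split=> [w /= ve|w [c _ [/= Nc Vc]] /=]; last by rewrite Nc.
by exists (N w).
Qed.

Lemma fiber_in_cst {D : countType} (c : D) : fiber_in F (fun=> c).
Proof.
move=> e; have [->|ce] := eqVneq c e.
  rewrite (_ : _ @^-1` _ = ~` set0); last by rewrite setC0; apply/seteqP; split.
  by apply: sigma_setC; exact: sigma_algebra0.
rewrite (_ : _ @^-1` _ = set0); first exact: sigma_algebra0.
by apply/seteqP; split => x //= /eqP; rewrite (negbTE ce).
Qed.

Lemma fiber_in_map2 {C D E : countType} (N : T -> C) (M : T -> D) (h : C -> D -> E) :
  fiber_in F N -> fiber_in F M -> fiber_in F (fun w => h (N w) (M w)).
Proof.
by move=> FN FM; apply: (@fiber_in_bind _ _ N (fun c => h c \o M)) => // c;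
  exact: fiber_in_comp.
Qed.

Lemma fiber_in_sum (X : nat -> T -> nat) n :
  (forall i, (i < n)%N -> fiber_in F (X i)) ->
  fiber_in F (fun w => (\sum_(i < n) X i w)%N).
Proof.
elim: n => [|n ih] FX.
  by under [X in fiber_in _ X]eq_fun do rewrite big_ord0; exact: fiber_in_cst.
under [X in fiber_in _ X]eq_fun do rewrite big_ord_recr /=.
apply: (@fiber_in_map2 _ _ _ _ _ addn); last exact: FX.
by apply: ih => i ni; apply: FX; exact: ltnW.
Qed.

End DiscreteFunctions.

Lemma sigma_cylinders_fiber {T : Type} {I : eqType} (X : I -> T -> nat)
  (J : set I) i : J i -> fiber_in <<s cylinders X J >> (X i).
Proof.
move=> Ji m; apply: sub_sigma_algebra; exists [:: i], (fun=> [set m]).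
split=> // [j|]; first by rewrite inE => /eqP ->.
apply/seteqP; split=> [w /= Xi j /=|w Cw]; first by rewrite inE => /eqP ->.
by apply: (Cw i); rewrite /= inE.
Qed.

(** * Conditioning on a discrete variable by freezing its value *)

Section Freezing.
Local Open Scope ereal_scope.
Context {d : measure_display} {T : measurableType d} {R : realType}.
Variable P : probability T R.

Lemma sigma_measurable : <<s @measurable d T >> = measurable.
Proof. by rewrite sigma_algebra_id//; exact: sigma_algebra_measurable. Qed.

Lemma measurable_fiber_in {C : countType} (N : T -> C) (S : set C) :
  fiber_in measurable N -> measurable (N @^-1` S).
Proof. by rewrite -sigma_measurable; exact: fiber_in_preimage. Qed.

Lemma fiber_measurable_fun {d'} {T' : measurableType d'} {C : countType}
    (N : T -> C) (h : C -> T') :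
  fiber_in measurable N -> measurable_fun setT (fun w => h (N w)).
Proof.
by move=> mN _ B mB; rewrite setTI; exact: (measurable_fiber_in N (h @^-1` B)).
Qed.

Lemma ge0_integral_fibers (N : T -> nat) (D : set T) (f : T -> \bar R) :
  fiber_in measurable N -> measurable D -> measurable_fun D f ->
  (forall w, 0 <= f w) ->
  \int[P]_(w in D) f w = \sum_(n <oo) \int[P]_(w in D `&` N @^-1` [set n]) f w.
Proof.
move=> mN mD mf f0.
have DE : D = \bigcup_n (D `&` N @^-1` [set n]).
  by apply/seteqP; split=> [w Dw|w [n _ []//]]; exists (N w).
rewrite {1}DE ge0_integral_bigcup//.
- by move=> n; apply: measurableI => //; exact: measurable_fiber_in.
- by rewrite -DE.
- by move=> i j _ _ [w [/= [_ <-] [_ <-]]].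
Qed.

Lemma ge0_integral_discrete (N : T -> nat) (D : set T) (g : nat -> \bar R) :
  fiber_in measurable N -> measurable D -> (forall n, 0 <= g n) ->
  \int[P]_(w in D) g (N w) = \sum_(n <oo) g n * P (D `&` N @^-1` [set n]).
Proof.
move=> mN mD g0; rewrite (ge0_integral_fibers N)//; last first.
  by apply: measurable_funS (fiber_measurable_fun N g mN).
apply: eq_eseriesr => n _; rewrite -integral_cst//.
  by apply: eq_integral => w /set_mem[_ /= ->].
by apply: measurableI => //; exact: measurable_fiber_in.
Qed.

Variables (N : T -> nat) (V : nat -> T -> nat).
Hypothesis mN : fiber_in measurable N.
Hypothesis mV : forall n, fiber_in measurable (V n).
Hypothesis indNV : forall n v, P (N @^-1` [set n] `&` V n @^-1` [set v]) =
  P (N @^-1` [set n]) * P (V n @^-1` [set v]).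

Lemma fiber_in_frozen : fiber_in measurable (fun w => (N w, V (N w) w)).
Proof.
rewrite -sigma_measurable.
apply: (@fiber_in_bind _ _ _ _ N (fun n w => (n, V n w))).
  by rewrite sigma_measurable.
move=> n; apply: (@fiber_in_comp _ _ _ _ (V n) (pair n)).
by rewrite sigma_measurable.
Qed.

(* Conditionally on [N = n], the variable [V n] keeps its law. *)
Lemma ge0_integral_freeze (G : nat -> nat -> \bar R) :
  (forall n v, 0 <= G n v) ->
  \int[P]_w G (N w) (V (N w) w) = \int[P]_w (\int[P]_w' G (N w) (V (N w) w')).
Proof.
move=> G0.
rewrite (ge0_integral_discrete N setT (fun n => \int[P]_w' G n (V n w')))//; last first.
  by move=> n; apply: integral_ge0.
rewrite (ge0_integral_fibers N)//; last first.
  exact: (fiber_measurable_fun _ (fun p => G p.1 p.2) fiber_in_frozen).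
apply: eq_eseriesr => n _; rewrite !setTI.
transitivity (\int[P]_(w in N @^-1` [set n]) G n (V n w)).
  by apply: eq_integral => w /set_mem /= ->.
have mNn : measurable (N @^-1` [set n]) by exact: measurable_fiber_in.
rewrite !(ge0_integral_discrete (V n))//.
rewrite muleC -(fineK (fin_num_measure P _ mNn)).
rewrite -nneseriesZl; last by move=> i _; exact: mule_ge0.
apply: eq_eseriesr => v _; rewrite fineK ?fin_num_measure//.
by rewrite setTI indNV muleCA.
Qed.

(** Positive and negative parts are frozen separately; their inner integrals agree because each
    frozen mean is zero. Integrability of the composite is a separate assumption, since it does not
    follow from that of each frozen variable and is needed to subtract the two parts. *)
Lemma integral_freeze0 (G : nat -> nat -> R) :
  (forall n, P.-integrable setT (fun w => (G n (V n w))%:E)) ->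
  (forall n, \int[P]_w (G n (V n w))%:E = 0) ->
  P.-integrable setT (fun w => (G (N w) (V (N w) w))%:E) ->
  \int[P]_w (G (N w) (V (N w) w))%:E = 0.
Proof.
move=> iG G0 iGN.
have eqpn n : \int[P]_w (EFin \o (fun w => G n (V n w)))^\+ w =
              \int[P]_w (EFin \o (fun w => G n (V n w)))^\- w.
  have pf := integrable_pos_fin_num measurableT (iG n).
  have nf := integrable_neg_fin_num measurableT (iG n).
  have := G0 n; rewrite integralE -(fineK pf) -(fineK nf) -EFinB => -[/subr0_eq pn].
  by rewrite -(fineK pf) -(fineK nf) pn.
pose f w := (G (N w) (V (N w) w))%:E.
have pn : \int[P]_w f^\+ w = \int[P]_w f^\- w.
  have Hp n v : 0 <= maxe (G n v)%:E 0 by rewrite le_max lexx orbT.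
  have Hn n v : 0 <= maxe (- (G n v)%:E) 0 by rewrite le_max lexx orbT.
  transitivity (\int[P]_w (\int[P]_w' maxe (G (N w) (V (N w) w'))%:E 0)).
    rewrite -(ge0_integral_freeze (fun n v => maxe (G n v)%:E 0)); last exact: Hp.
    by apply: eq_integral => w _; rewrite funeposE.
  transitivity (\int[P]_w (\int[P]_w' maxe (- (G (N w) (V (N w) w'))%:E) 0)).
    apply: eq_integral => w _; have := eqpn (N w).
    by under eq_integral do rewrite funeposE; under [RHS]eq_integral do rewrite funenegE.
  rewrite -(ge0_integral_freeze (fun n v => maxe (- (G n v)%:E) 0)); last exact: Hn.
  by apply: eq_integral => w _; rewrite funenegE.
by rewrite integralE pn subee// (integrable_neg_fin_num measurableT iGN).
Qed.

End Freezing.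

(** * A strong law for uncorrelated variables *)

Section RealIntegrals.
Local Open Scope ereal_scope.
Context {d : measure_display} {T : measurableType d} {R : realType}.
Variable P : probability T R.
Implicit Types f g : T -> R.

Lemma le_integral_real f g : measurable_fun setT f -> measurable_fun setT g ->
  (forall w, 0 <= f w <= g w)%R ->
  \int[P]_w (f w)%:E <= \int[P]_w (g w)%:E.
Proof.
move=> mf mg fg; apply: ge0_le_integral => //.
- by move=> w _; rewrite lee_fin; have /andP[] := fg w.
- exact/measurable_EFinP.
- exact/measurable_EFinP.
- by move=> w _; rewrite lee_fin; have /andP[] := fg w.
Qed.

Lemma ge0_integral_lin f g (a b : R) : measurable_fun setT f ->
  measurable_fun setT g -> (forall w, 0 <= f w)%R -> (forall w, 0 <= g w)%R ->
  (0 <= a)%R -> (0 <= b)%R ->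
  \int[P]_w (a * f w + b * g w)%:E =
  a%:E * \int[P]_w (f w)%:E + b%:E * \int[P]_w (g w)%:E.
Proof.
move=> mf mg f0 g0 a0 b0.
rewrite -!ge0_integralZl_EFin//; last 4 first.
- by move=> w _; rewrite lee_fin.
- exact/measurable_EFinP.
- by move=> w _; rewrite lee_fin.
- exact/measurable_EFinP.
rewrite -ge0_integralD//.
- by move=> w _; rewrite mule_ge0 ?lee_fin.
- by apply: emeasurable_funM => //; exact/measurable_EFinP.
- by move=> w _; rewrite mule_ge0 ?lee_fin.
- by apply: emeasurable_funM => //; exact/measurable_EFinP.
Qed.

Lemma integral_cst_real (c : R) : \int[P]_w c%:E = c%:E.
Proof. by rewrite integral_cst//= [P setT]probability_setT mule1. Qed.

Definition square_integrable f :=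
  measurable_fun setT f /\ \int[P]_w (f w ^+ 2)%:E < +oo.

Lemma square_integrable_le f c : measurable_fun setT f ->
  \int[P]_w (f w ^+ 2)%:E <= c%:E -> square_integrable f.
Proof. by move=> mf fc; split => //; exact: le_lt_trans fc (ltry _). Qed.

Lemma square_integrable_mul f g : square_integrable f -> square_integrable g ->
  P.-integrable setT (fun w => (f w * g w)%:E).
Proof.
move=> [mf foo] [mg goo].
have mfg : measurable_fun setT (fun w => f w * g w)%R by exact: measurable_funM.
apply/integrableP; split; first exact/measurable_EFinP.
apply: (@le_lt_trans _ _ (\int[P]_w (1 * f w ^+ 2 + 1 * g w ^+ 2)%:E)).
  apply: (@le_integral_real (fun w => `|f w * g w|)%R
    (fun w => 1 * f w ^+ 2 + 1 * g w ^+ 2)%R).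
  - exact: measurableT_comp.
  - by apply: measurable_funD; apply: measurable_funM => //; exact: measurable_funX.
  - move=> w; rewrite normr_ge0/= normrM -[(f w ^+ 2)%R]real_normK ?num_real// -[(g w ^+ 2)%R]real_normK ?num_real//.
    have := sqr_ge0 (`|f w| - `|g w|)%R; have := sqr_ge0 (`|f w| + `|g w|)%R; nra.
rewrite ge0_integral_lin//; last 4 first.
- exact: measurable_funX.
- exact: measurable_funX.
- by move=> w; exact: sqr_ge0.
- by move=> w; exact: sqr_ge0.
by rewrite !mul1e lte_add_pinfty.
Qed.

Lemma square_integrableD f g : square_integrable f -> square_integrable g ->
  square_integrable (fun w => f w + g w)%R.
Proof.
move=> [mf foo] [mg goo]; split; first exact: measurable_funD.
apply: (@le_lt_trans _ _ (\int[P]_w (2 * f w ^+ 2 + 2 * g w ^+ 2)%:E)).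
  apply: (@le_integral_real (fun w => (f w + g w) ^+ 2)%R
    (fun w => 2 * f w ^+ 2 + 2 * g w ^+ 2)%R).
  - by apply: measurable_funX; exact: measurable_funD.
  - by apply: measurable_funD; apply: measurable_funM => //; exact: measurable_funX.
  - by move=> w; rewrite sqr_ge0/=; have := sqr_ge0 (f w - g w)%R; nra.
rewrite ge0_integral_lin//; last 4 first.
- exact: measurable_funX.
- exact: measurable_funX.
- by move=> w; exact: sqr_ge0.
- by move=> w; exact: sqr_ge0.
by rewrite lte_add_pinfty// lte_mul_pinfty ?lee_fin.
Qed.

Lemma square_integrable_sum (X : nat -> T -> R) n :
  (forall k, square_integrable (X k)) ->
  square_integrable (fun w => \sum_(k < n) X k w)%R.
Proof.
move=> sX; elim: n => [|n ih].
  under [X in square_integrable X]eq_fun do rewrite big_ord0.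
  apply: (@square_integrable_le _ 0%R); first exact: measurable_cst.
  by rewrite expr0n/= integral_cst_real.
under [X in square_integrable X]eq_fun do rewrite big_ord_recr /=.
exact: square_integrableD.
Qed.

Lemma integral_sq_sum_orthogonal (X : nat -> T -> R) n :
  (forall k, square_integrable (X k)) ->
  (forall j k, (j < k)%N -> \int[P]_w (X j w * X k w)%:E = 0) ->
  \int[P]_w ((\sum_(k < n) X k w) ^+ 2)%:E =
  \sum_(k < n) \int[P]_w (X k w ^+ 2)%:E.
Proof.
move=> sX oX; elim: n => [|n ih].
  by under eq_integral do rewrite big_ord0 expr0n/=; rewrite big_ord0 integral_cst_real.
rewrite big_ord_recr /= -ih.
pose S w := (\sum_(k < n) X k w)%R.
have sS : square_integrable S by exact: square_integrable_sum.
have iSX : P.-integrable setT (fun w => (S w * X n w)%:E) by exact: square_integrable_mul.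
have iSS : P.-integrable setT (fun w => (S w ^+ 2)%:E).
  by under eq_fun do rewrite expr2; exact: square_integrable_mul.
have iXX : P.-integrable setT (fun w => (X n w ^+ 2)%:E).
  by under eq_fun do rewrite expr2; exact: square_integrable_mul.
transitivity (\int[P]_w ((S w ^+ 2)%:E + (2%:E * (S w * X n w)%:E + (X n w ^+ 2)%:E))).
  apply: eq_integral => w _; rewrite big_ord_recr /= -/(S w) -EFinM -!EFinD.
  by congr (_%:E); ring.
rewrite integralD//; last by apply: integrableD => //; exact: integrableZl.
rewrite integralD//; last exact: integrableZl.
rewrite integralZl//.
suff -> : \int[P]_w (S w * X n w)%:E = 0 by rewrite mule0 add0e.
under eq_integral do rewrite /S mulr_suml -sumEFin.
rewrite integral_sum//; first by rewrite big1// => i _; exact: oX.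
by move=> i; exact: square_integrable_mul.
Qed.

(** The series of the [Z m] has a finite integral, so it is almost surely finite and its terms,
    dominated by its tails, vanish. This does the work of Markov's inequality and Borel-Cantelli. *)
Lemma ae_cvg0_geometric (Z : nat -> T -> R) (C q : R) :
  (forall m, measurable_fun setT (Z m)) -> (forall m w, 0 <= Z m w)%R ->
  (0 <= C)%R -> (0 <= q < 1)%R ->
  (forall m, \int[P]_w (Z m w)%:E <= (C * q ^+ m)%:E) ->
  {ae P, forall w, (fun m => Z m w) @ \oo --> 0%R}.
Proof.
move=> mZ Z0 C0 /andP[q0 q1] ZC.
have mEZ m : measurable_fun setT (EFin \o Z m) by exact/measurable_EFinP.
have EZ0 m w : 0 <= (EFin \o Z m) w by rewrite lee_fin.
pose S w := \sum_(m <oo) (Z m w)%:E.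
have mS : measurable_fun setT S.
  exact: (@ge0_emeasurable_sum _ _ _ setT (fun m => EFin \o Z m) xpredT).
have Soo : \int[P]_w S w <= (C / (1 - q))%:E.
  rewrite integral_nneseries//; last by move=> m w _; exact: EZ0.
  apply: lime_le.
    apply: is_cvg_nneseries => m _ _; apply: integral_ge0 => w _; exact: EZ0.
  apply: nearW => n; apply: (@le_trans _ _ (\sum_(0 <= m < n) (C * q ^+ m)%:E)).
    by apply: lee_sum => m _; exact: ZC.
  rewrite sumEFin lee_fin big_mkord -mulr_sumr ler_wpM2l//.
  have q10 : (0 < 1 - q)%R by rewrite subr_gt0.
  rewrite -[leRHS]mul1r ler_pdivlMr// mulrC -opprB mulNr -subrX1 opprB.
  by rewrite gerBl exprn_ge0.
have iS : P.-integrable setT S.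
  apply/integrableP; split=> //; apply: le_lt_trans (ltry (C / (1 - q))).
  suff -> : \int[P]_w `|S w| = \int[P]_w S w by exact: Soo.
  apply: eq_integral => w _; rewrite gee0_abs//.
  by apply: nneseries_ge0 => k _ _; exact: EZ0.
apply: filterS (integrable_ae measurableT iS) => w /(_ I) Sfin.
have tail := @nneseries_tail_cvg R (fun m => (Z m w)%:E) xpredT.
have {}tail := tail _ (fun m _ => EZ0 m w).
suff /fine_cvg : (fun m => (Z m w)%:E) @ \oo --> 0%:E by [].
apply: (@squeeze_cvge _ _ _ _ (cst 0) _
  (fun N => \sum_(N <= k <oo) (Z k w)%:E)); [|exact: cvg_cst|apply: tail].
  apply: nearW => N; rewrite (EZ0 N w)/= (@nneseries_split _ _ N 1)//; last first.
    by move=> k _; exact: EZ0.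
  by rewrite addn1 big_nat1 leeDl// nneseries_ge0// => k _ _; exact: EZ0.
by move: Sfin; rewrite fin_numElt => /andP[].
Qed.

End RealIntegrals.

(** * Chaining over dyadic blocks *)

Section DyadicChaining.
Context {R : realType}.
Implicit Types x : nat -> R.

(** The squared block sums added up over all dyadic subintervals of [o, o + 2^m), one for each node
    of the binary tree of depth [m]. *)
Fixpoint dyadic_squares (x : nat -> R) (m o : nat) : R :=
  if m is m'.+1 then
    (\sum_(k < 2 ^ m) x (o + k)%N) ^+ 2 +
    (dyadic_squares x m' o + dyadic_squares x m' (o + 2 ^ m')%N)
  else x o ^+ 2.

Lemma dyadic_squares_ge0 x m o : 0 <= dyadic_squares x m o.
Proof. by elim: m o => [|m ih] o /=; rewrite ?sqr_ge0// !addr_ge0 ?sqr_ge0. Qed.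

Lemma dyadic_squares_top x m o :
  (\sum_(k < 2 ^ m) x (o + k)%N) ^+ 2 <= dyadic_squares x m o.
Proof.
case: m => [|m] /=; first by rewrite expn0 big_ord1 addn0.
by rewrite lerDl addr_ge0 ?dyadic_squares_ge0.
Qed.

(* Deterministic Rademacher-Menshov bound: an initial segment of a dyadic
   interval is a union of one dyadic subinterval per scale. *)
Lemma sq_partial_sum_dyadic x m o n : (n <= 2 ^ m)%N ->
  (\sum_(k < n) x (o + k)%N) ^+ 2 <= m.+1%:R * dyadic_squares x m o.
Proof.
elim: m o n => [|m ih] o n.
  rewrite expn0; case: n => [|[|//]] _.
    by rewrite big_ord0 expr0n/= mul1r sqr_ge0.
  by rewrite big_ord1 addn0 mul1r.
move=> nm; have [n2|n2] := leqP n (2 ^ m).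
  apply: (le_trans (ih o n n2)); apply: ler_pM => //.
  - exact: dyadic_squares_ge0.
  - by rewrite ler_nat.
  - by rewrite /= addrCA lerDl addr_ge0 ?dyadic_squares_ge0 ?sqr_ge0.
have -> : \sum_(k < n) x (o + k)%N = \sum_(k < 2 ^ m) x (o + k)%N +
    \sum_(k < n - 2 ^ m) x (o + 2 ^ m + k)%N.
  have split p q : \sum_(k < p + q) x (o + k)%N =
      \sum_(k < p) x (o + k)%N + \sum_(k < q) x (o + p + k)%N.
    rewrite big_split_ord /=; congr (_ + _).
    by apply: eq_bigr => k _; rewrite addnA.
  by have := split (2 ^ m)%N (n - 2 ^ m)%N; rewrite subnKC// ltnW.
set a := (X in X + _); set b := (X in _ + X).
have aT := dyadic_squares_top x m o; rewrite -/a in aT.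
have bT : b ^+ 2 <= m.+1%:R * dyadic_squares x m (o + 2 ^ m)%N.
  by apply: ih; rewrite leq_subLR addnn -mul2n -expnS.
rewrite /= mulrDr.
have t0 : 0 < m.+1%:R :> R by rewrite ltr0n.
(* Young's inequality with weight t = m + 1, chosen so that the inductive factor t on b^2 becomes (1
   + 1/t) t = t + 1, the same factor as on a^2. *)
have ab : (a + b) ^+ 2 <= (1 + m.+1%:R) * a ^+ 2 + (1 + m.+1%:R^-1) * b ^+ 2.
  rewrite -subr_ge0 (_ : _ - _ = m.+1%:R * (a - m.+1%:R^-1 * b) ^+ 2).
    by rewrite mulr_ge0 ?sqr_ge0 ?ltW.
  by field; rewrite (_ : 1 + m%:R = m.+1%:R) ?gt_eqF// -natr1 addrC.
rewrite -[m.+2%:R]natr1 [_ + 1]addrC.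
apply: (le_trans ab); rewrite -[leLHS]add0r lerD//.
  by rewrite mulr_ge0 ?addr_ge0 ?sqr_ge0// ltW.
rewrite mulrDr lerD//; first by rewrite ler_wpM2l// addr_ge0 ?ltW.
apply: (@le_trans _ _ ((1 + m.+1%:R^-1) * (m.+1%:R * dyadic_squares x m (o + 2 ^ m)))).
  by rewrite ler_wpM2l// addr_ge0 ?invr_ge0 ?ltW.
by rewrite mulrA mulrDl mulVf ?gt_eqF// mul1r [m.+1%:R + 1]addrC.
Qed.

End DyadicChaining.

Section OrthogonalSLLN.
Context {d : measure_display} {T : measurableType d} {R : realType}.
Variable P : probability T R.

Lemma measurable_dyadic_squares (X : nat -> T -> R) m o :
  (forall k, measurable_fun setT (X k)) ->
  measurable_fun setT (fun w => dyadic_squares (X^~ w) m o).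
Proof.
move=> mX; elim: m o => [|m ih] o /=; first exact: measurable_funX.
apply: measurable_funD; last by apply: measurable_funD; exact: ih.
by apply: measurable_funX; apply: measurable_sum => k.
Qed.

(** Each of the m + 1 scales partitions the interval into blocks, and by orthogonality the blocks of
    one scale contribute at most 2^m [B] altogether. *)
Lemma integral_dyadic_squares (X : nat -> T -> R) (B : R) m o :
  (forall k, square_integrable P (X k)) ->
  (forall j k, (j < k)%N -> \int[P]_w (X j w * X k w)%:E = 0)%E ->
  (forall k, (k < o + 2 ^ m)%N -> \int[P]_w (X k w ^+ 2)%:E <= B%:E)%E ->
  (\int[P]_w (dyadic_squares (X^~ w) m o)%:E <= (m.+1%:R * 2 ^+ m * B)%:E)%E.
Proof.
move=> sX oX.
have mX k : measurable_fun setT (X k) by case: (sX k).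
elim: m o => [|m ih] o XB /=.
  by rewrite expr0 !mul1r; apply: XB; rewrite expn0 addn1.
have S0 w : 0 <= (\sum_(k < 2 ^ m.+1) X (o + k)%N w) ^+ 2 by exact: sqr_ge0.
have mS : measurable_fun setT (fun w => (\sum_(k < 2 ^ m.+1) X (o + k)%N w) ^+ 2).
  by apply: measurable_funX; apply: measurable_sum => k.
have mD o' := @measurable_dyadic_squares X m o' mX.
under eq_integral do rewrite !EFinD.
have EFm (f : T -> R) : measurable_fun setT f -> measurable_fun setT (EFin \o f).
  by move=> mf; exact/measurable_EFinP.
rewrite ge0_integralD//; last 4 first.
- by move=> w _; rewrite lee_fin.
- exact: EFm.
- by move=> w _; rewrite -EFinD lee_fin addr_ge0// dyadic_squares_ge0.
- by apply: emeasurable_funD; exact: EFm.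
rewrite ge0_integralD//; last 4 first.
- by move=> w _; rewrite lee_fin dyadic_squares_ge0.
- exact: EFm.
- by move=> w _; rewrite lee_fin dyadic_squares_ge0.
- exact: EFm.
have -> : m.+2%:R * 2 ^+ m.+1 * B =
    (2 ^ m.+1)%:R * B + (m.+1%:R * 2 ^+ m * B + m.+1%:R * 2 ^+ m * B).
  by rewrite natrX -[m.+2%:R]natr1 exprS; ring.
rewrite !EFinD; apply: leeD; last first.
  apply: leeD; apply: ih => k ko; apply: XB; apply: (leq_trans ko).
    by rewrite leq_add2l leq_exp2l.
  by rewrite -addnA leq_add2l addnn -mul2n -expnS.
rewrite (integral_sq_sum_orthogonal P (fun k => X (o + k)%N)) //; last first.
  by move=> j k jk; apply: oX; rewrite ltn_add2l.
apply: (@le_trans _ _ (\sum_(k < 2 ^ m.+1) B%:E)%E).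
  by apply: lee_sum => k _; apply: XB; rewrite ltn_add2l.
by rewrite sumEFin sumr_const card_ord mulr_natl.
Qed.

(** Chaining costs (m + 1)^2: one factor is pathwise, the other counts the scales. Squaring (m + 1)
    / 16 <= (17/16)^m produces 256, and (17/16)^2 <= 7/6 turns the rate 3/4 into 7/8, still below
    1. *)
Lemma sq_succn_le_geometric m : m.+1%:R ^+ 2 * (3 / 4) ^+ m <= 256 * (7 / 8) ^+ m :> R.
Proof.
have bern : m.+1%:R / 16 <= (17 / 16) ^+ m :> R.
  elim: m => [|m ih]; first by rewrite expr0; lra.
  rewrite exprS -natr1.
  have m1 : 1 <= m.+1%:R :> R by rewrite ler1n.
  have [h|h] := leP (m.+1%:R : R) 16; last by lra.
  have : 1 <= (17 / 16) ^+ m :> R by rewrite exprn_ege1//; lra.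
  nra.
have -> : 256 * (7 / 8) ^+ m = 256 * (7 / 6) ^+ m * (3 / 4) ^+ m :> R.
  by rewrite -mulrA -exprMn; congr (_ * _ ^+ m); field.
rewrite ler_wpM2r ?exprn_ge0//.
have : (289 / 256) ^+ m <= (7 / 6) ^+ m :> R by rewrite lerXn2r ?nnegrE//; lra.
have -> : (289 / 256) ^+ m = ((17 / 16) ^+ m) ^+ 2 :> R.
  by rewrite -exprM mulnC exprM; congr (_ ^+ m); field.
have m1 : 0 <= m.+1%:R :> R by [].
have : (m.+1%:R / 16) ^+ 2 <= ((17 / 16) ^+ m) ^+ 2 :> R.
  by rewrite lerXn2r ?nnegrE ?exprn_ge0//; lra.
lra.
Qed.

Lemma cvgn_trunc_log_gt (M : nat) : \forall n \near \oo, (M < (trunc_log 2 n).+1)%N.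
Proof. by exists (2 ^ M)%N => // n /= Mn; rewrite ltnS; exact: trunc_log_max. Qed.

(* The growth rate 3/2 lies below 2, so that the variance of the averages
   decays, and its square lies above 2, as needed to truncate square integrable
   variables at level (3/2)^m in the m-th dyadic block. *)
Lemma orthogonal_SLLN (X : nat -> T -> R) (C : R) :
  (forall k, square_integrable P (X k)) ->
  (forall j k, (j < k)%N -> \int[P]_w (X j w * X k w)%:E = 0)%E ->
  0 <= C ->
  (forall m k, (k < 2 ^ m)%N ->
     \int[P]_w (X k w ^+ 2)%:E <= (C * (3 / 2) ^+ m)%:E)%E ->
  {ae P, forall w, (fun n => (\sum_(k < n) X k w) / n%:R) @ \oo --> 0}.
Proof.
move=> sX oX C0 XC.
have mX k : measurable_fun setT (X k) by case: (sX k).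
(* For 2^(m-1) <= n < 2^m chaining bounds the squared partial sum by 4^m [Z m], and 4^m <= 4 n^2, so
   [Z m] controls the squared averages over the whole block. *)
pose Z m w := m.+1%:R / 4 ^+ m * dyadic_squares (X^~ w) m 0%N.
have mZ m : measurable_fun setT (Z m).
  by apply: measurable_funM => //; exact: measurable_dyadic_squares.
have c0 m : 0 <= m.+1%:R / 4 ^+ m :> R by rewrite divr_ge0// exprn_ge0.
have Z0 m w : 0 <= Z m w by rewrite mulr_ge0// dyadic_squares_ge0.
have ZC m : (\int[P]_w (Z m w)%:E <= (256 * C * (7 / 8) ^+ m)%:E)%E.
  under eq_integral do rewrite /Z EFinM.
  rewrite ge0_integralZl_EFin//; last 2 first.
  - by move=> w _; rewrite lee_fin dyadic_squares_ge0.
  - by apply/measurable_EFinP; exact: measurable_dyadic_squares.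
  have := @integral_dyadic_squares X (C * (3 / 2) ^+ m) m 0%N sX oX.
  move=> /(_ (fun k => XC m k)) h.
  apply: (le_trans (lee_wpmul2l _ h)); first by rewrite lee_fin.
  rewrite -EFinM lee_fin.
  apply: (@le_trans _ _ (C * (m.+1%:R ^+ 2 * (3 / 4) ^+ m))).
    rewrite (_ : (3 / 4) ^+ m = (3 / 2) ^+ m * 2 ^+ m / 4 ^+ m).
      by rewrite le_eqVlt; apply/orP; left; apply/eqP; ring.
    by rewrite -exprMn -exprVn -exprMn; congr (_ ^+ m); field.
  rewrite (_ : 256 * C * (7 / 8) ^+ m = C * (256 * (7 / 8) ^+ m)); last by ring.
  by rewrite ler_wpM2l//; exact: sq_succn_le_geometric.
have q01 : 0 <= (7 / 8 : R) < 1 by lra.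
have C256 : 0 <= 256 * C by rewrite mulr_ge0.
apply: filterS (ae_cvg0_geometric P Z _ _ mZ Z0 C256 q01 ZC) => w Zw.
apply/cvgr0Pnorm_lt => e e0.
(* Halving [e] pays for the factor 4 between 4^m and n^2. *)
have e20 : 0 < (e / 2) ^+ 2 by rewrite exprn_gt0// divr_gt0.
move/cvgr0Pnorm_lt : Zw => /(_ _ e20)[M _ ZM].
near=> n.
have n0 : (0 < n)%N by near: n; exact: nbhs_infty_gt.
have /andP[ln nl] := trunc_log_bounds (isT : (1 < 2)%N) n0.
have := ZM (trunc_log 2 n).+1; rewrite /= ltnW; last first.
  by near: n; exact: cvgn_trunc_log_gt.
move=> /(_ isT); rewrite ger0_norm// => Zn.
set S := \sum_(k < n) X k w; set m := (trunc_log 2 n).+1 in Zn nl *.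
have Sn : S ^+ 2 <= m.+1%:R * dyadic_squares (X^~ w) m 0%N.
  exact: (sq_partial_sum_dyadic (X^~ w) m 0%N n (ltnW nl)).
have p0 : 0 < 4 ^+ m :> R by rewrite exprn_gt0.
have SZ : S ^+ 2 <= 4 ^+ m * Z m w.
  by apply: (le_trans Sn); rewrite /Z mulrA mulrCA divff ?gt_eqF// mulr1.
have n4 : 4 ^+ m <= 4 * n%:R ^+ 2 :> R.
  rewrite /m exprS ler_wpM2l// (_ : 4 = 2 ^+ 2); last by rewrite expr2; lra.
  by rewrite exprAC lerXn2r ?nnegrE ?exprn_ge0// -natrX ler_nat.
have nn0 : 0 < n%:R :> R by rewrite ltr0n.
rewrite -[e]gtr0_norm// -ltr_sqr ?nnegrE// !real_normK ?num_real//.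
rewrite exprMn exprVn ltr_pdivrMr ?exprn_gt0//.
apply: (le_lt_trans SZ); apply: (@lt_le_trans _ _ (4 ^+ m * (e / 2) ^+ 2)).
  by rewrite ltr_pM2l.
have := ler_wpM2r (ltW e20) n4; nra.
Unshelve. all: by end_near. Qed.

End OrthogonalSLLN.

(** * The INAR(1) process *)

Section InarMoments.
Context {d : measure_display} {T : measurableType d} {R : realType}.
Variables (P : probability T R) (alpha : R) (s theta : nat).
Variables (Y0 : T -> nat) (eps : nat -> T -> nat) (xi : nat -> nat -> T -> nat).
Local Notation fam := (inar_family Y0 eps xi).
Local Notation Y := (inar_Y s theta Y0 eps xi).

(** The variables that determine Y_0, ..., Y_k. The inequality is strict because, in the 0-based
    storage, [eps k] and [xi k] drive the step from Y_k to Y_{k+1}. *)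
Definition past_idx (k : nat) : set inar_idx :=
  [set i | match i with
           | None => True
           | Some (inl k') => (k' < k)%N
           | Some (inr (k', _)) => (k' < k)%N
           end].

Definition time_idx (k : nat) : set inar_idx :=
  [set i | match i with
           | None => False
           | Some (inl k') => k' = k
           | Some (inr (k', _)) => k' = k
           end].

Definition shift (k : nat) : nat := ((k.+1 == s) * theta)%N.

(** The state [x] is a parameter instead of the random Y_k: only then is the step independent of the
    past. The outlier is left to [shift]. *)
Definition transition (k x : nat) (w : T) : nat :=
  (\sum_(j < x) xi k j w + eps k w)%N.

(** The whole path is recorded, and not only its last state, since orthogonality of two martingale
    differences requires freezing the earlier one as well. *)
Definition history (k : nat) (w : T) : seq nat := mkseq (fun i => Y i w) k.+1.

Lemma inar_YS k w : Y k.+1 w = (transition k (Y k w) w + shift k)%N.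
Proof. by []. Qed.

Lemma nth_history k i w : (i <= k)%N -> nth 0%N (history k w) i = Y i w.
Proof. by move=> ik; rewrite nth_mkseq. Qed.

Lemma last_history k w : last 0%N (history k w) = Y k w.
Proof. by rewrite /history mkseqS last_rcons. Qed.

Lemma sub_cylinders_idx (J K : set inar_idx) : J `<=` K ->
  <<s cylinders fam J >> `<=` <<s cylinders fam K >>.
Proof.
move=> JK; apply: sub_sigma_algebra2 => _ [t [A [ut tJ ->]]].
by exists t, A; split=> // i /tJ /JK.
Qed.

Lemma transition_fiber_in k x :
  fiber_in <<s cylinders fam (time_idx k) >> (transition k x).
Proof.
apply: (@fiber_in_map2 _ _ _ _ _ _ _ addn).
  apply: fiber_in_sum => j _.
  exact: (@sigma_cylinders_fiber _ _ fam _ (Some (inr (k, j)))).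
exact: (@sigma_cylinders_fiber _ _ fam _ (Some (inl k))).
Qed.

Lemma history_fiber_in k :
  fiber_in <<s cylinders fam (past_idx k) >> (history k).
Proof.
elim: k => [|k ih].
  apply: (@fiber_in_comp _ _ _ _ Y0 (fun y => [:: y])).
  exact: (@sigma_cylinders_fiber _ _ fam _ None).
have sub1 : past_idx k `<=` past_idx k.+1.
  by move=> [[k'|[k' j]]|] //= /ltnW.
have sub2 : time_idx k `<=` past_idx k.+1.
  by move=> [[k'|[k' j]]|] //= ->.
rewrite (_ : history k.+1 = fun w => rcons (history k w)
    (transition k (last 0%N (history k w)) w + shift k)%N); last first.
  by apply/funext => w; rewrite last_history -inar_YS /history mkseqS.
apply: (@fiber_in_bind _ _ _ _ (history k)
  (fun h w => rcons h (transition k (last 0%N h) w + shift k)%N)).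
  by move=> h; apply: (sub_cylinders_idx _ _ sub1).
move=> h.
apply: (@fiber_in_comp _ _ _ _ (transition k (last 0%N h))
  (fun v => rcons h (v + shift k)%N)).
by move=> v; apply: (sub_cylinders_idx _ _ sub2); exact: transition_fiber_in.
Qed.

Hypothesis mfam : forall i m, measurable (fam i @^-1` [set m]).
Hypothesis indfam : mutually_independent P fam.

Lemma fiber_in_measurable_cylinders {C : Type} (J : set inar_idx) (N : T -> C) :
  fiber_in <<s cylinders fam J >> N -> fiber_in measurable N.
Proof.
by move=> FN c; apply: (@sub_sigma_cylinders_measurable _ _ _ fam mfam J).
Qed.

(** Freezing is stated for a conditioning variable in [nat], hence the encoding of the path as a
    number. *)
Definition history_code k w : nat := pickle (history k w).
Definition history_decode (n : nat) : seq nat := odflt [::] (@unpickle (seq nat) n).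

Lemma history_codeK k w : history_decode (history_code k w) = history k w.
Proof. by rewrite /history_decode /history_code pickleK. Qed.

Lemma measurable_history k : fiber_in measurable (history k).
Proof. exact: fiber_in_measurable_cylinders (history_fiber_in k). Qed.

Lemma measurable_transition k x : fiber_in measurable (transition k x).
Proof. exact: fiber_in_measurable_cylinders (transition_fiber_in k x). Qed.

Lemma measurable_inar k : fiber_in measurable (Y k).
Proof.
rewrite (_ : Y k = last 0%N \o history k); last first.
  by apply/funext => w; rewrite -(last_history k w).
rewrite -sigma_measurable; apply: fiber_in_comp.
by rewrite sigma_measurable; exact: measurable_history.
Qed.

Lemma measurable_history_code k : fiber_in measurable (history_code k).
Proof.
rewrite -sigma_measurable; apply: (@fiber_in_comp _ _ _ _ (history k) pickle).
by rewrite sigma_measurable; exact: measurable_history.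
Qed.

Lemma indep_history_transition k n x v :
  P (history_code k @^-1` [set n] `&` transition k x @^-1` [set v]) =
  (P (history_code k @^-1` [set n]) * P (transition k x @^-1` [set v]))%E.
Proof.
apply: (@indep_sigma_cylinders _ _ _ P _ fam mfam indfam (past_idx k) (time_idx k)).
- apply/seteqP; split=> // -[[k'|[k' j]]|] //= [+ k'k].
  + by rewrite k'k ltnn.
  + by rewrite k'k ltnn.
  + by case: k'k.
- exact: (fiber_in_comp _ _ (pickle : seq nat -> nat) (history_fiber_in k) n).
- exact: transition_fiber_in.
Qed.

Lemma ge0_integral_inar k (G : seq nat -> nat -> R) :
  (forall h v, 0 <= G h v) ->
  (\int[P]_w (G (history k w) (transition k (Y k w) w))%:E =
   \int[P]_w \int[P]_w' (G (history k w) (transition k (Y k w) w'))%:E)%E.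
Proof.
move=> G0.
have := @ge0_integral_freeze _ _ _ P (history_code k)
  (fun n => transition k (last 0%N (history_decode n))) (measurable_history_code k)
  (fun n => measurable_transition k _)
  (fun n v => indep_history_transition k n _ v)
  (fun n v => (G (history_decode n) v)%:E)
  (fun n v => G0 _ v).
under eq_integral do rewrite history_codeK last_history.
by under [in RHS]eq_integral do
  (under eq_integral do rewrite history_codeK last_history).
Qed.

Lemma integral_inar0 k (G : seq nat -> nat -> R) :
  (forall h, P.-integrable setT (fun w => (G h (transition k (last 0%N h) w))%:E)) ->
  (forall h, \int[P]_w (G h (transition k (last 0%N h) w))%:E = 0)%E ->
  P.-integrable setT (fun w => (G (history k w) (transition k (Y k w) w))%:E) ->
  (\int[P]_w (G (history k w) (transition k (Y k w) w))%:E = 0)%E.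
Proof.
move=> iG G0 iGh.
have E : (fun w => (G (history_decode (history_code k w))
    (transition k (last 0%N (history_decode (history_code k w))) w))%:E) =
    (fun w => (G (history k w) (transition k (Y k w) w))%:E).
  by apply/funext => w; rewrite history_codeK last_history.
have := @integral_freeze0 _ _ _ P (history_code k)
  (fun n => transition k (last 0%N (history_decode n))) (measurable_history_code k)
  (fun n => measurable_transition k _)
  (fun n v => indep_history_transition k n _ v)
  (fun n v => G (history_decode n) v)
  (fun n => iG _) (fun n => G0 _).
rewrite /= E; exact.
Qed.

End InarMoments.

(** * Centred variables and integrals determined by a discrete law *)

Section CenteredVariables.
Local Open Scope ereal_scope.
Context {d : measure_display} {T : measurableType d} {R : realType}.
Variable P : probability T R.

Lemma square_integrable_cst (c : R) : square_integrable P (fun=> c).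
Proof.
apply: (@square_integrable_le _ _ _ P _ (c ^+ 2)%R); first exact: measurable_cst.
by rewrite integral_cst_real.
Qed.

Lemma square_integrable_integrable (f : T -> R) : square_integrable P f ->
  P.-integrable setT (EFin \o f).
Proof.
move=> sf; have := square_integrable_mul P _ _ sf (square_integrable_cst 1%R).
by under eq_fun do rewrite mulr1.
Qed.

Lemma integral_centered (f : T -> R) (c : R) : square_integrable P f ->
  \int[P]_w (f w)%:E = c%:E -> \int[P]_w (f w - c)%:E = 0.
Proof.
move=> sf fc; under eq_integral do rewrite EFinB.
rewrite integralB_EFin//; last 2 first.
- exact: square_integrable_integrable.
- by apply: square_integrable_integrable; exact: square_integrable_cst.
by rewrite fc integral_cst_real -EFinB subrr.
Qed.

Lemma square_integrable_centered (f : T -> R) (c : R) : square_integrable P f ->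
  square_integrable P (fun w => f w - c)%R.
Proof. by move=> sf; apply: square_integrableD => //; exact: square_integrable_cst. Qed.

Lemma square_integrable_scale (f : T -> R) (c : R) : square_integrable P f ->
  square_integrable P (fun w => c * f w)%R.
Proof.
move=> [mf foo]; split; first exact: measurable_funM.
under eq_integral do rewrite exprMn EFinM.
rewrite ge0_integralZl_EFin ?sqr_ge0//.
- by rewrite lte_mul_pinfty// lee_fin sqr_ge0.
- by move=> w _; rewrite lee_fin sqr_ge0.
- by apply/measurable_EFinP; exact: measurable_funX.
Qed.

Lemma ge0_integral_law (N M : T -> nat) (F : nat -> \bar R) :
  fiber_in measurable N -> fiber_in measurable M ->
  (forall m, P (N @^-1` [set m]) = P (M @^-1` [set m])) ->
  (forall n, 0 <= F n) -> \int[P]_w F (N w) = \int[P]_w F (M w).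
Proof.
move=> mN mM NM F0; rewrite !ge0_integral_discrete//.
by apply: eq_eseriesr => n _; rewrite !setTI NM.
Qed.

Lemma ge0_integral_bernoulli (N : T -> nat) (a : R) (F : nat -> \bar R) :
  fiber_in measurable N -> P (N @^-1` [set 1%N]) = a%:E ->
  P (N @^-1` [set 0%N]) = (1 - a)%:E -> (forall n, 0 <= F n) ->
  \int[P]_w F (N w) = F 0%N * (1 - a)%:E + F 1%N * a%:E.
Proof.
move=> mN N1 N0 F0; rewrite ge0_integral_discrete//.
(* The masses at 0 and 1 already add up to 1, so every other value is null. *)
have Nn n : P (N @^-1` [set n.+2]) = 0.
  have : P ((N @^-1` [set 0%N] `|` N @^-1` [set 1%N]) `|` N @^-1` [set n.+2]) <= 1.
    apply: probability_le1.
    by apply: measurableU; [apply: measurableU|]; exact: measurable_fiber_in.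
  rewrite measureU; last 3 first.
  - by apply: measurableU; exact: measurable_fiber_in.
  - exact: measurable_fiber_in.
  - by apply/seteqP; split=> // w [[/= ->|/= ->]].
  rewrite measureU; last 3 first.
  - exact: measurable_fiber_in.
  - exact: measurable_fiber_in.
  - by apply/seteqP; split=> // w [/= ->].
  move=> h; apply/eqP; rewrite eq_le measure_ge0 andbT.
  move: h; rewrite [X in X + _ + _]N0 [X in _ + X + _]N1 -EFinD subrK.
  have pf : P (N @^-1` [set n.+2]) \is a fin_num.
    by rewrite fin_num_measure//; exact: measurable_fiber_in.
  move=> h; have {h} : 1%:E + P (N @^-1` [set n.+2]) <= 1%:E := h.
  by rewrite -(fineK pf) -EFinD !lee_fin; lra.
rewrite (@nneseries_split _ _ 0%N 2); last by move=> k _; rewrite mule_ge0.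
rewrite add0n big_nat_recr//= big_nat1 !setTI N0 N1 eseries0 ?adde0//.
by move=> [|[|n]]// _ _; rewrite setTI Nn mule0.
Qed.

End CenteredVariables.

(** * Mean and variance of one transition from a fixed state *)

Section InarLaws.
Context {d : measure_display} {T : measurableType d} {R : realType}.
Variables (P : probability T R) (alpha : R) (s theta : nat).
Variables (Y0 : T -> nat) (eps : nat -> T -> nat) (xi : nat -> nat -> T -> nat).
Local Notation fam := (inar_family Y0 eps xi).
Local Notation Y := (inar_Y s theta Y0 eps xi).
Hypothesis alpha01 : 0 < alpha < 1.
Hypothesis mfam : forall i m, measurable (fam i @^-1` [set m]).
Hypothesis indfam : mutually_independent P fam.
Hypothesis eps_law :
  forall k m, P (eps k @^-1` [set m]) = P (eps 0%N @^-1` [set m]).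
Hypothesis eps_sq : P.-integrable setT (fun w => (((eps 0%N w)%:R : R) ^+ 2)%:E).
Hypothesis xi_law : forall k j, P (xi k j @^-1` [set 1%N]) = alpha%:E /\
                                P (xi k j @^-1` [set 0%N]) = (1 - alpha)%:E.

Definition eps_mean : R := fine (\int[P]_w ((eps 0%N w)%:R)%:E)%E.
Definition eps_var : R := fine (\int[P]_w (((eps 0%N w)%:R - eps_mean) ^+ 2)%:E)%E.

Local Notation mu := eps_mean.

Let meps k : fiber_in measurable (eps k). Proof. exact: (mfam (Some (inl k))). Qed.
Let mxi k j : fiber_in measurable (xi k j).
Proof. exact: (mfam (Some (inr (k, j)))). Qed.

Lemma eps_square_integrable k : square_integrable P (fun w => (eps k w)%:R).
Proof.
split; first exact: (fiber_measurable_fun (eps k) (fun n => n%:R : R) (meps k)).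
rewrite (ge0_integral_law P (eps k) (eps 0%N) (fun n => (n%:R ^+ 2)%:E))//.
by case/integrableP: eps_sq => _; under eq_integral do rewrite gee0_abs ?lee_fin ?sqr_ge0//.
Qed.

Lemma integral_eps k : (\int[P]_w ((eps k w)%:R)%:E = mu%:E)%E.
Proof.
rewrite (ge0_integral_law P (eps k) (eps 0%N) (fun n => (n%:R)%:E))//.
rewrite fineK//; apply: integrable_fin_num => //.
exact: square_integrable_integrable (eps_square_integrable 0%N).
Qed.

Lemma integral_eps_centered_sq k :
  (\int[P]_w (((eps k w)%:R - mu) ^+ 2)%:E = eps_var%:E)%E.
Proof.
rewrite (ge0_integral_law P (eps k) (eps 0%N) (fun n => ((n%:R - mu) ^+ 2)%:E))//.
  rewrite fineK// ge0_fin_numE.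
    by case: (square_integrable_centered P _ mu (eps_square_integrable 0%N)).
  by apply: integral_ge0 => w _; rewrite lee_fin sqr_ge0.
by move=> n; rewrite lee_fin sqr_ge0.
Qed.

Lemma eps_var_ge0 : 0 <= eps_var.
Proof.
by rewrite fine_ge0//; apply: integral_ge0 => w _; rewrite lee_fin sqr_ge0.
Qed.

Lemma eps_mean_ge0 : 0 <= mu.
Proof. by rewrite fine_ge0//; apply: integral_ge0 => w _; rewrite lee_fin. Qed.

Lemma xi_square_integrable k j : square_integrable P (fun w => (xi k j w)%:R).
Proof.
split; first exact: (fiber_measurable_fun (xi k j) (fun n => n%:R : R) (mxi k j)).
have [x1 x0] := xi_law k j.
rewrite (ge0_integral_bernoulli P (xi k j) alpha (fun n => (n%:R ^+ 2)%:E))//.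
by rewrite -!EFinM -EFinD ltry.
Qed.

Lemma integral_xi k j : (\int[P]_w ((xi k j w)%:R)%:E = alpha%:E)%E.
Proof.
have [x1 x0] := xi_law k j.
rewrite (ge0_integral_bernoulli P (xi k j) alpha (fun n => (n%:R)%:E))//.
by rewrite -!EFinM -EFinD mul0r add0r mul1r.
Qed.

Lemma integral_xi_centered_sq k j :
  (\int[P]_w (((xi k j w)%:R - alpha) ^+ 2)%:E <= 1%:E)%E.
Proof.
have [x1 x0] := xi_law k j.
rewrite (ge0_integral_bernoulli P (xi k j) alpha (fun n => ((n%:R - alpha) ^+ 2)%:E))//.
  by rewrite -!EFinM -EFinD lee_fin; move: alpha01 => /andP[a0 a1]; nra.
by move=> n; rewrite lee_fin sqr_ge0.
Qed.

Lemma xi_orthogonal k i j : (i < j)%N ->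
  (\int[P]_w (((xi k i w)%:R - alpha) * ((xi k j w)%:R - alpha))%:E = 0)%E.
Proof.
move=> ij.
have sc j' := square_integrable_centered P _ alpha (xi_square_integrable k j').
have E0 j' := integral_centered P _ _ (xi_square_integrable k j') (integral_xi k j').
apply: (@integral_freeze0 _ _ _ P (xi k i) (fun=> xi k j) _ _ _
  (fun n v => (n%:R - alpha) * (v%:R - alpha))) => //.
- move=> n v.
  apply: (@indep_sigma_cylinders _ _ _ P _ fam mfam indfam
    [set Some (inr (k, i))] [set Some (inr (k, j))]).
  + by apply/seteqP; split=> // x [/= -> [ji]]; rewrite ji ltnn in ij.
  + exact: (@sigma_cylinders_fiber _ _ fam _ (Some (inr (k, i)))).
  + exact: (@sigma_cylinders_fiber _ _ fam _ (Some (inr (k, j)))).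
- move=> n; apply: square_integrable_integrable.
  exact: square_integrable_scale.
- move=> n; under eq_integral do rewrite EFinM.
  rewrite integralZl//; last exact: square_integrable_integrable.
  by rewrite E0 mule0.
- exact: square_integrable_mul.
Qed.

(** The argument [v] is the new state before the outlier is added, so one formula yields M_k at
    every time, including the outlier step. *)
Definition innovation (x v : nat) : R := v%:R - alpha * x%:R - mu.

Lemma innovation_transition k x w : innovation x (transition eps xi k x w) =
  \sum_(j < x) ((xi k j w)%:R - alpha) + ((eps k w)%:R - mu).
Proof.
rewrite /innovation /transition natrD natr_sum sumrB sumr_const card_ord.
by rewrite -mulr_natr; ring.
Qed.

Lemma innovation_square_integrable k x :
  square_integrable P (fun w => innovation x (transition eps xi k x w)).
Proof.
under eq_fun do rewrite innovation_transition.
apply: square_integrableD.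
  apply: (@square_integrable_sum _ _ _ P (fun j w => (xi k j w)%:R - alpha)) => j.
  exact: square_integrable_centered (xi_square_integrable _ _).
exact: square_integrable_centered (eps_square_integrable _).
Qed.

Lemma integral_innovation k x :
  (\int[P]_w (innovation x (transition eps xi k x w))%:E = 0)%E.
Proof.
have sx j := square_integrable_centered P _ alpha (xi_square_integrable k j).
under eq_integral do rewrite innovation_transition EFinD -sumEFin.
rewrite integralD//; last 2 first.
- by apply: integrable_sum => // j _; exact: square_integrable_integrable.
- exact: square_integrable_integrable (square_integrable_centered P _ mu (eps_square_integrable k)).
rewrite integral_sum//; last by move=> j; exact: square_integrable_integrable.
rewrite big1 ?add0e.
  by apply: integral_centered; [exact: eps_square_integrable|exact: integral_eps].
by move=> j _; apply: integral_centered; [exact: xi_square_integrable|exact: integral_xi].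
Qed.

(** From (a + b)^2 <= 2 a^2 + 2 b^2, with each Bernoulli variance bounded by 1, the second moment is
    at most 2 x + 2 [eps_var], which this rate times 1 + x dominates. *)
Definition innovation_rate : R := 2 + 2 * eps_var.

Lemma integral_innovation_sq k x :
  (\int[P]_w (innovation x (transition eps xi k x w) ^+ 2)%:E <=
   (innovation_rate * (1 + x%:R))%:E)%E.
Proof.
have sx j := square_integrable_centered P _ alpha (xi_square_integrable k j).
have se := square_integrable_centered P _ mu (eps_square_integrable k).
pose S w := \sum_(j < x) ((xi k j w)%:R - alpha).
have [mS _] : square_integrable P S.
  exact: (square_integrable_sum P (fun j w => (xi k j w)%:R - alpha) x sx).
have me := se.1.
apply: (@le_trans _ _ (\int[P]_w (2 * S w ^+ 2 + 2 * ((eps k w)%:R - mu) ^+ 2)%:E)%E).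
  apply: (le_integral_real P (fun w => innovation x (transition eps xi k x w) ^+ 2)
    (fun w => 2 * S w ^+ 2 + 2 * ((eps k w)%:R - mu) ^+ 2)).
  - by apply: measurable_funX; case: (innovation_square_integrable k x).
  - by apply: measurable_funD; apply: measurable_funM => //; exact: measurable_funX.
  - move=> w; rewrite sqr_ge0 innovation_transition -/(S w)/=.
    by have := sqr_ge0 (S w - ((eps k w)%:R - mu)); nra.
rewrite ge0_integral_lin//; last 4 first.
- exact: measurable_funX.
- exact: measurable_funX.
- by move=> w; exact: sqr_ge0.
- by move=> w; exact: sqr_ge0.
rewrite integral_eps_centered_sq /S.
rewrite (integral_sq_sum_orthogonal P (fun j w => (xi k j w)%:R - alpha) x sx); last first.
  by move=> i j ij; exact: xi_orthogonal.
apply: (@le_trans _ _ (2%:E * x%:R%:E + 2%:E * eps_var%:E)%E).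
  rewrite leeD2r// lee_wpmul2l ?lee_fin//.
  apply: (@le_trans _ _ (\sum_(j < x) 1%:E)%E).
    by apply: lee_sum => j _; exact: integral_xi_centered_sq.
  by rewrite sumEFin sumr_const card_ord.
rewrite -!EFinM -EFinD lee_fin /innovation_rate.
by have := eps_var_ge0; have : 0 <= x%:R :> R by []; nra.
Qed.

End InarLaws.

(** * Moment bounds and almost sure limits for the process *)

Section InarAlmostSure.
Context {d : measure_display} {T : measurableType d} {R : realType}.
Variables (P : probability T R) (alpha : R) (s theta : nat).
Variables (Y0 : T -> nat) (eps : nat -> T -> nat) (xi : nat -> nat -> T -> nat).
Local Notation fam := (inar_family Y0 eps xi).
Local Notation Y := (inar_Y s theta Y0 eps xi).
Local Notation next := (transition eps xi).
Local Notation mu := (eps_mean P eps : R).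
Local Notation K := (innovation_rate P eps : R).
Local Notation innov := (innovation P alpha eps).
Hypothesis alpha01 : 0 < alpha < 1.
Hypothesis mfam : forall i m, measurable (fam i @^-1` [set m]).
Hypothesis indfam : mutually_independent P fam.
Hypothesis eps_law :
  forall k m, P (eps k @^-1` [set m]) = P (eps 0%N @^-1` [set m]).
Hypothesis eps_sq : P.-integrable setT (fun w => (((eps 0%N w)%:R : R) ^+ 2)%:E).
Hypothesis xi_law : forall k j, P (xi k j @^-1` [set 1%N]) = alpha%:E /\
                                P (xi k j @^-1` [set 0%N]) = (1 - alpha)%:E.
Hypothesis Y0_sq : P.-integrable setT (fun w => (((Y0 w)%:R : R) ^+ 2)%:E).

Let moff k x : fiber_in measurable (next k x).
Proof. exact: (measurable_transition _ _ _ mfam). Qed.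

Let mY k : fiber_in measurable (Y k).
Proof. exact: (measurable_inar _ _ _ _ _ mfam). Qed.

Let K_ge0 : 0 <= K.
Proof. by rewrite addr_ge0// mulr_ge0// eps_var_ge0. Qed.

Lemma measurable_inar_fun (f : nat -> R) k : measurable_fun setT (fun w => f (Y k w)).
Proof. exact: (fiber_measurable_fun (Y k) f (mY k)). Qed.

Lemma measurable_transition_fun (f : nat -> R) k x :
  measurable_fun setT (fun w => f (next k x w)).
Proof. exact: (fiber_measurable_fun (next k x) f (moff k x)). Qed.

Lemma measurable_inar_step (G : nat -> nat -> R) k :
  measurable_fun setT (fun w => G (Y k w) (next k (Y k w) w)).
Proof.
have m2 : fiber_in measurable (fun w => (Y k w, next k (Y k w) w)).
  exact: (fiber_in_frozen (Y k) (next k)).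
exact: (fiber_measurable_fun _ (fun p => G p.1 p.2) m2).
Qed.

(** A bound valid for every frozen state is integrated against the law of Y_k. *)
Lemma ge0_integral_inar_le k (G : nat -> nat -> R) (b : nat -> R) :
  (forall x v, 0 <= G x v) ->
  (forall x, \int[P]_w (G x (next k x w))%:E <= (b x)%:E)%E ->
  (\int[P]_w (G (Y k w) (next k (Y k w) w))%:E <= \int[P]_w (b (Y k w))%:E)%E.
Proof.
move=> G0 Gb.
have := @ge0_integral_inar _ _ _ P s theta Y0 eps xi mfam indfam k
  (fun h v => G (last 0%N h) v) (fun h v => G0 _ v).
under eq_integral do rewrite last_history.
under [in X in _ = X -> _]eq_integral do
  (under eq_integral do rewrite last_history).
move=> ->; apply: ge0_le_integral => //.
- by move=> w _; apply: integral_ge0 => w' _; rewrite lee_fin.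
- exact: (fiber_measurable_fun (Y k) (fun x => \int[P]_w' (G x (next k x w'))%:E)%E).
- by apply/measurable_EFinP; exact: measurable_inar_fun.
Qed.

(** The initial second moment plus the fixed point of v -> (1 + alpha)/2 v + C, the affine recursion
    that dominates E[Y_k^2]. *)
Definition moment_bound : R :=
  let c := mu + theta%:R in
  let b := 2 * K / (1 - alpha) in
  fine (\int[P]_w ((Y0 w)%:R ^+ 2)%:E)%E +
  ((2 * c ^+ 2 + 2 * K) / (1 - alpha) + b ^+ 2 / (2 * (1 - alpha))) /
  ((1 - alpha) / 2).

Local Notation B := moment_bound.

Lemma moment_bound_ge0 : 0 <= B.
Proof.
move: alpha01 => /andP[a0 a1].
have a10 : 0 <= 1 - alpha by lra.
have m0 := eps_mean_ge0 P eps.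
have F0 : 0 <= fine (\int[P]_w ((Y0 w)%:R ^+ 2)%:E)%E :> R.
  by rewrite fine_ge0//; apply: integral_ge0 => w _; rewrite lee_fin sqr_ge0.
rewrite /moment_bound; apply: addr_ge0 => //; apply: divr_ge0; last by lra.
apply: addr_ge0; apply: divr_ge0 => //.
- by apply: addr_ge0; apply: mulr_ge0 => //; exact: sqr_ge0.
- exact: sqr_ge0.
- by lra.
Qed.

Lemma integral_inar_sq k : (\int[P]_w ((Y k w)%:R ^+ 2)%:E <= B%:E)%E.
Proof.
move: (alpha01) => /andP[a0 a1].
have a10 : 0 < 1 - alpha by lra.
have m0 := eps_mean_ge0 P eps.
set c := mu + theta%:R.
set b := 2 * K / (1 - alpha).
set C := (2 * c ^+ 2 + 2 * K) / (1 - alpha) + b ^+ 2 / (2 * (1 - alpha)).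
have C0 : 0 <= C.
  apply: addr_ge0; apply: divr_ge0.
  - by apply: addr_ge0; apply: mulr_ge0 => //; exact: sqr_ge0.
  - exact: ltW.
  - exact: sqr_ge0.
  - by lra.
have BE : B = fine (\int[P]_w ((Y0 w)%:R ^+ 2)%:E)%E + C / ((1 - alpha) / 2) by [].
have Y0fin : (\int[P]_w (((Y0 w)%:R : R) ^+ 2)%:E)%E \is a fin_num.
  by apply: integrable_fin_num.
have F0 : 0 <= fine (\int[P]_w ((Y0 w)%:R ^+ 2)%:E)%E :> R.
  by rewrite fine_ge0//; apply: integral_ge0 => w _; rewrite lee_fin sqr_ge0.
elim: k => [|k ih].
  by rewrite /= -(fineK Y0fin) lee_fin BE lerDl divr_ge0//; lra.
have step x : (\int[P]_w ((next k x w + shift s theta k)%:R ^+ 2)%:E <=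
    ((1 + alpha) / 2 * x%:R ^+ 2 + C)%:E)%E.
  pose A := alpha * x%:R ^+ 2 + 2 * c ^+ 2 / (1 - alpha).
  have A0 : 0 <= A.
    apply: addr_ge0; first by apply: mulr_ge0; [lra|exact: sqr_ge0].
    by apply: divr_ge0; [apply: mulr_ge0 => //; exact: sqr_ge0|lra].
  have minn := measurable_transition_fun (fun v => innov x v ^+ 2) k x.
  apply: (@le_trans _ _ (\int[P]_w (A * 1 + (2 / (1 - alpha)) *
      innov x (next k x w) ^+ 2)%:E)%E).
    apply: (le_integral_real P (fun w => (next k x w + shift s theta k)%:R ^+ 2)
      (fun w => A * 1 + (2 / (1 - alpha)) * innov x (next k x w) ^+ 2)).
    - exact: (measurable_transition_fun (fun v => (v + shift s theta k)%:R ^+ 2)).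
    - exact: (measurable_transition_fun
        (fun v => A * 1 + (2 / (1 - alpha)) * innov x v ^+ 2)).
    - move=> w; rewrite sqr_ge0/=.
      set i := innov x _.
      have -> : (next k x w + shift s theta k)%:R =
          alpha * x%:R + (mu + (shift s theta k)%:R + i) :> R.
        by rewrite natrD /i /innovation; ring.
      have sh0 : 0 <= (shift s theta k)%:R :> R by [].
      have sh1 : (shift s theta k)%:R <= theta%:R :> R.
        by rewrite ler_nat /shift; case: eqP => _; rewrite ?mul1n.
      set r := mu + _ + i.
      have r2 : r ^+ 2 <= 2 * c ^+ 2 + 2 * i ^+ 2.
        have : (mu + (shift s theta k)%:R) ^+ 2 <= c ^+ 2.
          by rewrite lerXn2r ?nnegrE ?addr_ge0// /c lerD2l.
        have := sqr_ge0 (mu + (shift s theta k)%:R - i); rewrite /r; nra.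
      (* Convexity of the square for the weights alpha and 1 - alpha: the coefficient of x^2 stays
         below 1, which splitting the square with factors 2 would not guarantee. *)
      have cvx : (alpha * x%:R + r) ^+ 2 <= alpha * x%:R ^+ 2 + r ^+ 2 / (1 - alpha).
        rewrite -subr_ge0 (_ : _ - _ =
          alpha * (1 - alpha) * (x%:R - r / (1 - alpha)) ^+ 2).
          by apply: mulr_ge0; [apply: mulr_ge0; lra|exact: sqr_ge0].
        by field; rewrite gt_eqF.
      apply: (le_trans cvx); rewrite /A mulr1 -addrA lerD2l.
      rewrite [leRHS](_ : _ = (2 * c ^+ 2 + 2 * i ^+ 2) / (1 - alpha)); last by ring.
      by rewrite ler_pM2r// invr_gt0.
  rewrite (ge0_integral_lin P (fun=> 1))//; last 2 first.
  - by move=> w; exact: sqr_ge0.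
  - by rewrite divr_ge0//; lra.
  rewrite integral_cst_real.
  have := integral_innovation_sq P alpha Y0 eps xi alpha01 mfam indfam eps_law eps_sq xi_law k x.
  move=> h; apply: (@le_trans _ _
    (A%:E * 1%:E + (2 / (1 - alpha))%:E * (K * (1 + x%:R))%:E)%E).
    by rewrite leeD2l// lee_wpmul2l// lee_fin divr_ge0//; lra.
  rewrite -!EFinM -EFinD lee_fin mulr1 /A /C.
  have -> : 2 / (1 - alpha) * (K * (1 + x%:R)) = 2 * K / (1 - alpha) + b * x%:R.
    by rewrite /b; ring.
  (* The conditional variance is linear in x; Young's inequality absorbs it into half of the gap 1 -
     alpha, leaving the coefficient alpha + (1 - alpha)/2 = (1 + alpha)/2. *)
  have am : b * x%:R <= (1 - alpha) / 2 * x%:R ^+ 2 + b ^+ 2 / (2 * (1 - alpha)).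
    rewrite -subr_ge0 (_ : _ - _ =
      (1 - alpha) / 2 * (x%:R - b / (1 - alpha)) ^+ 2).
      by rewrite mulr_ge0 ?sqr_ge0//; lra.
    by field; rewrite gt_eqF.
  rewrite [(2 * c ^+ 2 + 2 * K) / _]mulrDl; lra.
under eq_integral do rewrite inar_YS.
apply: (le_trans (@ge0_integral_inar_le k
  (fun x v => (v + shift s theta k)%:R ^+ 2) _ (fun x v => sqr_ge0 _) step)).
under eq_integral do rewrite -[C]mulr1.
rewrite (ge0_integral_lin P (fun w => (Y k w)%:R ^+ 2) (fun=> 1))//; last 2 first.
- exact: (measurable_inar_fun (fun n => n%:R ^+ 2)).
- lra.
rewrite integral_cst_real -/C.
apply: (@le_trans _ _ (((1 + alpha) / 2)%:E * B%:E + C%:E * 1%:E)%E).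
  by rewrite leeD2r// lee_wpmul2l// lee_fin; lra.
rewrite -!EFinM -EFinD lee_fin mulr1.
have : C <= (1 - alpha) / 2 * B.
  rewrite BE mulrDr mulrCA divff ?mulr1; last by rewrite gt_eqF//; lra.
  by rewrite lerDr mulr_ge0//; lra.
lra.
Qed.

(** The centred functions [H k] of a transition are martingale differences, hence orthogonal along
    the process. The factor 1 + x^2 is what the bounded second moments of Y_k can pay for; the
    factor (3/2)^m leaves room for truncation. *)
Lemma inar_SLLN (H : nat -> nat -> nat -> R) (C : R) : 0 <= C ->
  (forall k x, square_integrable P (fun w => H k x (next k x w))) ->
  (forall k x, \int[P]_w (H k x (next k x w))%:E = 0)%E ->
  (forall m k x, (k < 2 ^ m)%N ->
    \int[P]_w (H k x (next k x w) ^+ 2)%:E <=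
      (C * (3 / 2) ^+ m * (1 + x%:R ^+ 2))%:E)%E ->
  {ae P, forall w,
    (fun n => (\sum_(k < n) H k (Y k w) (next k (Y k w) w)) / n%:R) @ \oo --> 0}.
Proof.
move=> C0 sH H0 HC.
pose X k w := H k (Y k w) (next k (Y k w) w).
have XC m k : (k < 2 ^ m)%N ->
    (\int[P]_w (X k w ^+ 2)%:E <= (C * (1 + B) * (3 / 2) ^+ m)%:E)%E.
  move=> km.
  apply: (le_trans (@ge0_integral_inar_le k (fun x v => H k x v ^+ 2) _
    (fun x v => sqr_ge0 _) (fun x => HC m k x km))).
  have D0 : 0 <= C * (3 / 2) ^+ m by rewrite mulr_ge0// exprn_ge0//; lra.
  under eq_integral do rewrite mulrDr.
  rewrite (ge0_integral_lin P (fun=> 1) (fun w => (Y k w)%:R ^+ 2))//; last first.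
    exact: (measurable_inar_fun (fun n => n%:R ^+ 2)).
  rewrite integral_cst_real.
  apply: (@le_trans _ _ ((C * (3 / 2) ^+ m)%:E * 1%:E + (C * (3 / 2) ^+ m)%:E * B%:E)%E).
    by rewrite leeD2l// lee_wpmul2l ?lee_fin// integral_inar_sq.
  by rewrite -!EFinM -EFinD lee_fin le_eqVlt; apply/orP; left; apply/eqP; ring.
have sX k : square_integrable P (X k).
  apply: (@square_integrable_le _ _ _ P _ (C * (1 + B) * (3 / 2) ^+ k)).
    exact: measurable_inar_step.
  by apply: XC; rewrite ltn_expl.
apply: (orthogonal_SLLN P X (C * (1 + B))) => //; last first.
  by rewrite mulr_ge0// addr_ge0// moment_bound_ge0.
move=> j k jk.
(* The earlier difference is read off the path; subtracting [shift] recovers the transition value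
   exactly, since the shift was added to it. *)
pose G (h : seq nat) v :=
  H j (nth 0%N h j) (nth 0%N h j.+1 - shift s theta j)%N * H k (last 0%N h) v.
have GX w : G (history s theta Y0 eps xi k w) (next k (Y k w) w) = X j w * X k w.
  by rewrite /G !nth_history ?(ltnW jk)// last_history inar_YS addnK.
have iG : P.-integrable setT
    (fun w => (G (history s theta Y0 eps xi k w) (next k (Y k w) w))%:E).
  by under eq_fun do rewrite GX; exact: square_integrable_mul.
under eq_integral do rewrite -GX.
apply: (@integral_inar0 _ _ _ P s theta Y0 eps xi mfam indfam k G _ _ iG) => h.
  apply: square_integrable_integrable.
  exact: square_integrable_scale.
under eq_integral do rewrite /G EFinM.
rewrite integralZl//; last exact: square_integrable_integrable.
by rewrite H0 mule0.
Qed.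

Definition change_prob k x : R := fine (\int[P]_w ((next k x w != x)%:R)%:E)%E.

Lemma integral_change k x :
  (\int[P]_w ((next k x w != x)%:R)%:E = (change_prob k x)%:E)%E.
Proof.
rewrite fineK// ge0_fin_numE; last first.
  by apply: integral_ge0 => w _; rewrite lee_fin.
apply: (@le_lt_trans _ _ (\int[P]_w 1%:E)%E); last by rewrite integral_cst_real ltry.
apply: (le_integral_real P (fun w => (next k x w != x)%:R) (fun=> 1)) => //.
  exact: (measurable_transition_fun (fun v => (v != x)%:R)).
by move=> w; rewrite ler0n lern1 leq_b1.
Qed.

Lemma change_prob_le1 k x : change_prob k x <= 1.
Proof.
rewrite -lee_fin -integral_change -(integral_cst_real P 1).
apply: (le_integral_real P (fun w => (next k x w != x)%:R) (fun=> 1)) => //.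
  exact: (measurable_transition_fun (fun v => (v != x)%:R)).
by move=> w; rewrite ler0n lern1 leq_b1.
Qed.

Lemma change_prob_ge0 k x : 0 <= change_prob k x.
Proof. by rewrite fine_ge0//; apply: integral_ge0 => w _; rewrite lee_fin. Qed.

Hypothesis eps_pos : (0 < P (eps 0%N @^-1` [set m | m != 0%N]))%E.

(* Given the immigrants and the other x - 1 thinning variables, at most one
   value of the last Bernoulli variable leaves the state x unchanged. *)
Lemma change_prob_gt0 : exists2 delta : R, 0 < delta & forall k x, delta <= change_prob k x.
Proof.
move: (alpha01) => /andP[a0 a1].
have meps k : fiber_in measurable (eps k) by exact: (mfam (Some (inl k))).
have mS : measurable (eps 0%N @^-1` [set m | m != 0%N]).
  exact: measurable_fiber_in.
have pfin : P (eps 0%N @^-1` [set m | m != 0%N]) \is a fin_num.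
  by rewrite fin_num_measure.
pose p : R := fine (P (eps 0%N @^-1` [set m | m != 0%N])).
have p0 : 0 < p by rewrite -lte_fin /p fineK.
pose q : R := Num.min alpha (1 - alpha).
have q0 : 0 < q by rewrite lt_min a0 subr_gt0.
have qa : q <= alpha by rewrite ge_min lexx.
have qb : q <= 1 - alpha by rewrite ge_min lexx orbT.
exists (Num.min q p); first by rewrite lt_min q0.
move=> k x; rewrite -lee_fin -integral_change.
(* State 0 is left as soon as an immigrant arrives, with probability [p]; from a positive state the
   last thinning variable alone guarantees [q]. *)
case: x => [|x].
  apply: (@le_trans _ _ p%:E); first by rewrite lee_fin ge_min lexx orbT.
  have -> : (\int[P]_w ((next k 0 w != 0)%:R)%:E = \int[P]_w ((eps k w != 0%N)%:R)%:E)%E.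
    by apply: eq_integral => w _; rewrite /transition big_ord0 add0n.
  rewrite (ge0_integral_law P (eps k) (eps 0%N) (fun n => ((n != 0%N)%:R)%:E))//.
  rewrite /p fineK// -[X in P X]setIT -integral_indic//.
  rewrite le_eqVlt; apply/orP; left; apply/eqP; apply: eq_integral => w _.
  rewrite indicE; congr ((nat_of_bool _)%:R%:E); apply/idP/idP => [/set_mem//|e0].
  exact/mem_set.
apply: (@le_trans _ _ q%:E); first by rewrite lee_fin ge_min lexx.
have -> : (\int[P]_w ((next k x.+1 w != x.+1)%:R)%:E =
    \int[P]_w ((next k x w + xi k x w != x.+1)%N%:R)%:E)%E.
  by apply: eq_integral => w _; rewrite /transition big_ord_recr /= addnAC.
rewrite (@ge0_integral_freeze _ _ _ P (next k x) (fun=> xi k x) _ _ _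
  (fun n v => ((n + v != x.+1)%N%:R)%:E))//.
- rewrite -[leLHS](integral_cst_real P); apply: ge0_le_integral => //.
  + by move=> w _; rewrite lee_fin ltW.
  + exact: (fiber_measurable_fun (next k x)
      (fun n => \int[P]_w' ((n + xi k x w' != x.+1)%N%:R)%:E)%E).
  + move=> w _; have [x1 x0] := xi_law k x.
    rewrite (ge0_integral_bernoulli P (xi k x) alpha
      (fun v => ((next k x w + v != x.+1)%N%:R)%:E))//; last first.
      exact: (mfam (Some (inr (k, x)))).
    rewrite -!EFinM -EFinD lee_fin addn0 addn1 eqSS.
    have [->|] := eqVneq (next k x w) x.
      by rewrite mul0r addr0 neq_ltn ltnSn mul1r.
    by rewrite mul1r => _; rewrite (le_trans qa)// lerDr mulr_ge0// subr_ge0 ltW.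
- by move=> _; exact: (mfam (Some (inr (k, x)))).
- move=> n v.
  apply: (@indep_sigma_cylinders _ _ _ P _ fam mfam indfam
    [set i | i = Some (inl k) \/ exists2 j, (j < x)%N & i = Some (inr (k, j))]
    [set Some (inr (k, x))]).
  + by apply/seteqP; split=> // i [/= [->//|[j jx ->]] [jE]]; rewrite jE ltnn in jx.
  + apply: (@fiber_in_map2 _ _ _ _ _ _ _ addn).
      apply: fiber_in_sum => j jx.
      by apply: (@sigma_cylinders_fiber _ _ fam _ (Some (inr (k, j)))); right; exists j.
    by apply: (@sigma_cylinders_fiber _ _ fam _ (Some (inl k))); left.
  + exact: (@sigma_cylinders_fiber _ _ fam _ (Some (inr (k, x)))).
Qed.

Lemma ae_average_change :
  {ae P, forall w, (fun n => (\sum_(k < n)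
     ((next k (Y k w) w != Y k w)%:R - change_prob k (Y k w))) / n%:R) @ \oo --> 0}.
Proof.
have mH k x : measurable_fun setT (fun w => (next k x w != x)%:R - change_prob k x).
  exact: (measurable_transition_fun (fun v => (v != x)%:R - change_prob k x)).
have H1 k x : (\int[P]_w (((next k x w != x)%:R - change_prob k x) ^+ 2)%:E <= 1%:E)%E.
  rewrite -[leRHS](integral_cst_real P).
  apply: (le_integral_real P (fun w => ((next k x w != x)%:R - change_prob k x) ^+ 2)
    (fun=> 1)) => //; first exact: measurable_funX.
  have c0 := change_prob_ge0 k x; have c1 := change_prob_le1 k x.
  by move=> w; rewrite sqr_ge0/=; case: (_ != _) => /=; nra.
apply: (inar_SLLN (fun k x v => (v != x)%:R - change_prob k x) 1) => //.
- by move=> k x; exact: square_integrable_le (H1 k x).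
- move=> k x; apply: integral_centered; last exact: integral_change.
  apply: (@square_integrable_le _ _ _ P _ 1).
    exact: (measurable_transition_fun (fun v => (v != x)%:R)).
  rewrite -[leRHS](integral_cst_real P).
  apply: (le_integral_real P (fun w => (next k x w != x)%:R ^+ 2) (fun=> 1)) => //.
    exact: (measurable_transition_fun (fun v => (v != x)%:R ^+ 2)).
  by move=> w; case: (_ != _); rewrite ?expr1n ?expr0n lexx ler01.
- move=> m k x _; apply: (le_trans (H1 k x)); rewrite lee_fin mul1r.
  have : 1 <= (3 / 2) ^+ m :> R by rewrite exprn_ege1//; lra.
  have : 0 <= x%:R ^+ 2 :> R by exact: sqr_ge0.
  nra.
Qed.

Lemma ae_average_innovation :
  {ae P, forall w,
    (fun n => (\sum_(k < n) innov (Y k w) (next k (Y k w) w)) / n%:R) @ \oo --> 0}.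
Proof.
apply: (inar_SLLN (fun k x v => innov x v) (2 * K)) => //.
- by rewrite mulr_ge0.
- by move=> k x; exact: (innovation_square_integrable P alpha Y0).
- by move=> k x; exact: (integral_innovation P alpha Y0).
- move=> m k x _.
  have := integral_innovation_sq P alpha Y0 eps xi alpha01 mfam indfam eps_law eps_sq xi_law k x.
  move=> h; apply: (le_trans h); rewrite lee_fin.
  rewrite [2 * K]mulrC -!mulrA ler_wpM2l//.
  have m1 : 1 <= (3 / 2) ^+ m :> R by rewrite exprn_ege1//; lra.
  have := sqr_ge0 (x%:R - 1 : R); have := sqr_ge0 (x%:R : R); nra.
Qed.

Definition truncation (k : nat) : R := (3 / 2) ^+ trunc_log 2 k.

(** The conditional second moment of Y_k M_k is of order Y_k^3. On the truncation event 1 + x <= 2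
    (3/2)^m, so one power of x is traded for the admissible growth factor and second moments
    suffice. *)
Lemma ae_average_truncated :
  {ae P, forall w, (fun n => (\sum_(k < n)
    ((Y k w)%:R <= truncation k)%R%:R * (Y k w)%:R * innov (Y k w) (next k (Y k w) w))
    / n%:R) @ \oo --> 0}.
Proof.
have si k x := innovation_square_integrable P alpha Y0 eps xi mfam eps_law eps_sq xi_law k x.
apply: (inar_SLLN (fun k x v => (x%:R <= truncation k)%R%:R * x%:R * innov x v) (2 * K)) => //.
- by rewrite mulr_ge0.
- by move=> k x; exact: square_integrable_scale.
- move=> k x; under eq_integral do rewrite EFinM.
  rewrite integralZl//; last exact: square_integrable_integrable.
  by rewrite (integral_innovation P alpha Y0)// mule0.
- move=> m k x km.
  have := integral_innovation_sq P alpha Y0 eps xi alpha01 mfam indfam eps_law eps_sq xi_law k x.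
  move=> h; under eq_integral do rewrite exprMn EFinM.
  rewrite ge0_integralZl_EFin ?sqr_ge0//; last 2 first.
  + by move=> w _; rewrite lee_fin sqr_ge0.
  + by apply/measurable_EFinP; apply: measurable_funX; exact: (si k x).1.
  apply: (@le_trans _ _ (((x%:R <= truncation k)%R%:R * x%:R) ^+ 2 * (K * (1 + x%:R)))%:E).
    by rewrite [leRHS]EFinM lee_wpmul2l// lee_fin sqr_ge0.
  rewrite lee_fin.
  have tk : truncation k <= (3 / 2) ^+ m.
    rewrite /truncation ler_weXn2l//; first by lra.
    have [->|k0] := posnP k; first by rewrite trunc_log0.
    have := trunc_logP (isT : (1 < 2)%N) k0.
    move=> /leq_ltn_trans /(_ km); rewrite ltn_exp2l//; exact: ltnW.
  have m1 : 1 <= (3 / 2) ^+ m :> R by rewrite exprn_ege1//; lra.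
  set q := (3 / 2) ^+ m in tk m1 *.
  have x0 : 0 <= x%:R :> R by [].
  case: (leP x%:R (truncation k)) => [xt|_].
    have x1 : 1 + x%:R <= 2 * q by lra.
    have := ler_wpM2l (sqr_ge0 (x%:R : R)) x1; rewrite mul1r => xq.
    have := ler_wpM2l K_ge0 xq; have := mulr_ge0 K_ge0 (le_trans ler01 m1).
    nra.
  rewrite mul0r expr0n mul0r !mulr_ge0// ?(le_trans ler01 m1)//.
Qed.

(** With 4/9 = (2/3)^2, [Z m] < 1 forces every Y in the m-th dyadic block below (3/2)^m. The block
    has 2^m terms, so the mean of [Z m] is at most [B] (8/9)^m. *)
Lemma ae_eventually_le_truncation :
  {ae P, forall w, \forall k \near \oo, (Y k w)%:R <= truncation k}.
Proof.
pose Z m w : R := (4 / 9) ^+ m * \sum_(i < 2 ^ m) (Y (2 ^ m + i)%N w)%:R ^+ 2.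
have mY2 k : measurable_fun setT (fun w => (Y k w)%:R ^+ 2 : R).
  exact: (measurable_inar_fun (fun n => n%:R ^+ 2)).
have c0 m : 0 <= (4 / 9) ^+ m :> R by rewrite exprn_ge0//; lra.
have Z0 m w : 0 <= Z m w.
  by rewrite mulr_ge0// sumr_ge0// => i _; exact: sqr_ge0.
have mS m : measurable_fun setT (fun w => \sum_(i < 2 ^ m) (Y (2 ^ m + i)%N w)%:R ^+ 2 : R).
  by apply: measurable_sum => i; exact: mY2.
have mZ m : measurable_fun setT (Z m) by apply: measurable_funM.
have ZB m : (\int[P]_w (Z m w)%:E <= (B * (8 / 9) ^+ m)%:E)%E.
  under eq_integral do rewrite EFinM.
  rewrite ge0_integralZl_EFin//; last 2 first.
  - by move=> w _; rewrite lee_fin sumr_ge0// => i _; exact: sqr_ge0.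
  - exact/measurable_EFinP.
  under eq_integral do rewrite -sumEFin.
  rewrite ge0_integral_sum//; last by move=> i; apply/measurable_EFinP; exact: mY2.
  apply: (@le_trans _ _ (((4 / 9) ^+ m)%:E * \sum_(i < 2 ^ m) B%:E)%E).
    rewrite lee_wpmul2l ?lee_fin//; apply: lee_sum => i _; exact: integral_inar_sq.
  rewrite sumEFin sumr_const card_ord -EFinM lee_fin -[B *+ _]mulr_natl natrX.
  rewrite mulrA -exprMn mulrC (_ : 4 / 9 * 2 = 8 / 9)//; by field.
have q01 : 0 <= (8 / 9 : R) < 1 by lra.
apply: filterS (ae_cvg0_geometric P Z _ _ mZ Z0 moment_bound_ge0 q01 ZB) => w Zw.
move/cvgr0Pnorm_lt : Zw => /(_ 1 ltr01)[M _ ZM].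
near=> k.
have k0 : (0 < k)%N by near: k; exact: nbhs_infty_gt.
have /andP[lk kl] := trunc_log_bounds (isT : (1 < 2)%N) k0.
have Mk : (M < (trunc_log 2 k).+1)%N by near: k; exact: cvgn_trunc_log_gt.
have := ZM (trunc_log 2 k); rewrite /= -ltnS; set m := trunc_log 2 k in lk kl Mk *.
move=> /(_ Mk); rewrite ger0_norm// => Zm.
have t0 : 0 <= (3 / 2 : R) ^+ m by rewrite exprn_ge0//; lra.
rewrite /truncation -/m -ler_sqr ?nnegrE//.
have km : (k - 2 ^ m < 2 ^ m)%N by rewrite ltn_subLR// addnn -mul2n -expnS.
have Yk : (Y k w)%:R ^+ 2 <= \sum_(i < 2 ^ m) (Y (2 ^ m + i)%N w)%:R ^+ 2 :> R.
  rewrite (bigD1 (Ordinal km))//= subnKC// lerDl sumr_ge0// => i _; exact: sqr_ge0.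
have inv1 : ((3 / 2) ^+ m) ^+ 2 * (4 / 9) ^+ m = 1 :> R.
  by rewrite -exprM mulnC exprM -exprMn (_ : _ * _ = 1) ?expr1n//; field.
apply: (le_trans Yk); apply: (@le_trans _ _ (((3 / 2) ^+ m) ^+ 2 * Z m w)).
  by rewrite /Z mulrA inv1 mul1r.
by rewrite -[leRHS]mulr1 ler_wpM2l ?sqr_ge0// ltW.
Unshelve. all: by end_near. Qed.

End InarAlmostSure.

(** * Least squares along a deterministic path *)

Section LeastSquares.
Context {R : realType}.
Implicit Types (y f g : nat -> R) (s n : nat).

Lemma sum_sE r n (f : nat -> R) :
  sum_s r.+1 n f = \sum_(i < n | i != r :> nat) f i.+1.
Proof. by rewrite /sum_s big_add1 /= big_mkord. Qed.

Lemma sum_s1 s n : (1 <= s <= n)%N -> sum_s s n (fun=> 1) = n%:R - 1 :> R.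
Proof.
case: s => [//|r] /= rn; rewrite sum_sE.
have : \sum_(i < n) 1 = n%:R :> R by rewrite sumr_const card_ord.
by rewrite (bigD1 (Ordinal rn))//= => <-; rewrite addrC addrK.
Qed.

Lemma sum_sD s n f g : sum_s s n (fun k => f k + g k) = sum_s s n f + sum_s s n g.
Proof. exact: big_split. Qed.

Lemma sum_sZ s n (c : R) f : sum_s s n (fun k => c * f k) = c * sum_s s n f.
Proof. by rewrite /sum_s mulr_sumr. Qed.

Lemma eq_sum_s s n f g : (forall k, (0 < k)%N -> k != s -> f k = g k) ->
  sum_s s n f = sum_s s n g.
Proof.
move=> fg; rewrite /sum_s big_nat_cond [RHS]big_nat_cond.
by apply: eq_bigr => k /andP[/andP[k0 _] ks]; exact: fg.
Qed.

Lemma sum_residual_sq s n y (a m : R) : (1 <= s <= n)%N ->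
  sum_s s n (fun k => (y k - a * y k.-1 - m) ^+ 2) =
  sum_s s n (fun k => y k ^+ 2) + a ^+ 2 * sum_s s n (fun k => y k.-1 ^+ 2)
  + m ^+ 2 * (n%:R - 1) - 2 * a * sum_s s n (fun k => y k.-1 * y k)
  - 2 * m * sum_s s n y + 2 * a * m * sum_s s n (fun k => y k.-1).
Proof.
move=> sn; rewrite -(sum_s1 s n sn) -!mulNr -!sum_sZ -!sum_sD.
by apply: eq_sum_s => k _ _; ring.
Qed.

Lemma sum_centered_sq s n y (c : R) : (1 <= s <= n)%N ->
  sum_s s n (fun k => (y k.-1 - c) ^+ 2) =
  sum_s s n (fun k => y k.-1 ^+ 2) - 2 * c * sum_s s n (fun k => y k.-1)
  + c ^+ 2 * (n%:R - 1).
Proof.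
move=> sn; rewrite -(sum_s1 s n sn) -!mulNr -!sum_sZ -!sum_sD.
by apply: eq_sum_s => k _ _; ring.
Qed.

Section NormalEquations.
Variables (s n : nat) (y : nat -> R).
Hypothesis sn : (1 <= s <= n)%N.
Local Notation N := (n%:R - 1 : R).
Local Notation S1 := (sum_s s n (fun k => y k.-1)).
Local Notation S2 := (sum_s s n (fun k => y k.-1 ^+ 2)).
Local Notation S01 := (sum_s s n (fun k => y k.-1 * y k)).
Local Notation S0 := (sum_s s n y).
Local Notation D := (Dn s n y).
Hypothesis D_neq0 : D != 0.

Lemma normal_equation_slope : S01 = alpha_hat s n y * S2 + mu_hat s n y * S1.
Proof.
by move: D_neq0; rewrite /alpha_hat /mu_hat /Dn => D0; field.
Qed.

Lemma normal_equation_intercept : S0 = alpha_hat s n y * S1 + mu_hat s n y * N.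
Proof.
by move: D_neq0; rewrite /alpha_hat /mu_hat /Dn => D0; field.
Qed.

End NormalEquations.

(** At the candidate the residual at time [s] is zero and the normal equations cancel the linear
    terms. The excess is thus u^2 plus a quadratic form in the deviations of slope and intercept,
    with determinant D_n; completing the square shows which summand is positive when a given
    parameter differs. *)
Lemma Qn_lt_minimizer s n y (a m t : R) : (1 <= s <= n)%N -> 1 < n%:R :> R ->
  0 < Dn s n y ->
  (a, m, t) <> (alpha_hat s n y, mu_hat s n y, theta_hat s n y) ->
  Qn s n y (alpha_hat s n y) (mu_hat s n y) (theta_hat s n y) < Qn s n y a m t.
Proof.
move=> sn n1 D0 neq.
have Dneq : Dn s n y != 0 by rewrite gt_eqF.
have eqU := normal_equation_slope s n y Dneq.
have eqT := normal_equation_intercept s n y Dneq.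
rewrite /Qn !sum_residual_sq// -subr_gt0.
have -> : y s - alpha_hat s n y * y s.-1 - mu_hat s n y - theta_hat s n y = 0.
  by rewrite /theta_hat subrr.
rewrite eqU eqT; set ah := alpha_hat s n y in neq *; set mh := mu_hat s n y in neq *.
have D0' : 0 < (n%:R - 1) * sum_s s n (fun k => y k.-1 ^+ 2) -
  sum_s s n (fun k => y k.-1) ^+ 2 by exact: D0.
move: D0'; set S2 := sum_s s n (fun k => y k.-1 ^+ 2).
set S1 := sum_s s n (fun k => y k.-1); set N := n%:R - 1 => D0'.
have N0 : 0 < N by rewrite subr_gt0.
set u := y s - a * y s.-1 - m - t.
rewrite [ltRHS](_ : _ = (a - ah) ^+ 2 * S2 + 2 * (a - ah) * (m - mh) * S1 +
  (m - mh) ^+ 2 * N + u ^+ 2); last by ring.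
have qE : (a - ah) ^+ 2 * S2 + 2 * (a - ah) * (m - mh) * S1 + (m - mh) ^+ 2 * N =
  (((m - mh) * N + (a - ah) * S1) ^+ 2 + (N * S2 - S1 ^+ 2) * (a - ah) ^+ 2) / N.
  by field; rewrite gt_eqF.
rewrite qE.
have [ea|na] := eqVneq a ah; last first.
  rewrite ltr_pwDl ?sqr_ge0// divr_gt0// ltr_wpDl ?sqr_ge0// mulr_gt0//.
  by rewrite exprn_even_gt0//= subr_eq0.
have [em|nm] := eqVneq m mh; last first.
  rewrite ea subrr mul0r addr0 expr0n/= mulr0 addr0 ltr_pwDl ?sqr_ge0// divr_gt0//.
  by rewrite exprn_even_gt0//= mulf_neq0 ?subr_eq0// gt_eqF.
rewrite ltr_wpDl//.
  apply: divr_ge0; last exact: ltW.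
  by apply: addr_ge0; [|apply: mulr_ge0; [exact: ltW|]]; exact: sqr_ge0.
rewrite exprn_even_gt0//= /u subr_eq0; apply/eqP => te; apply: neq.
by rewrite -te ea em.
Qed.

(** Each change is at most 2 [z i] + 2 [z i.+1], so every deviation is used twice, except that the
    last one is used only once. Index [r] has no deviation, which spoils the changes out of [r] and
    into [r]; each costs at most 1, whence the two indicators. *)
Lemma sum_changes_le r y (c : R) (ch : nat -> R) (m : nat) :
  let z i := if i != r then (y i - c) ^+ 2 else 0 in
  (forall i, 0 <= ch i <= 1) ->
  (forall i, i != r -> ch i <= (y i.+1 - y i) ^+ 2) ->
  \sum_(i < m) ch i <=
    4 * (\sum_(i < m.+1) z i) - 2 * z m + (r < m)%N%:R + (r <= m)%N%:R.
Proof.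
move=> z ch01 chy.
have z0 i : 0 <= z i by rewrite /z; case: ifP => // _; exact: sqr_ge0.
elim: m => [|m ih].
  by rewrite big_ord0 big_ord1 ltn0 addr0 addr_ge0//; have := z0 0%N; lra.
rewrite [leLHS]big_ord_recr [in leRHS]big_ord_recr /=.
have step : ch m <= 2 * z m + 2 * z m.+1 + (m == r)%:R + (m.+1 == r)%:R.
  have /andP[c0 c1] := ch01 m.
  have [e1|n1] := eqVneq m r.
    have := z0 m; have := z0 m.+1; have : 0 <= (m.+1 == r)%:R :> R by [].
    by rewrite /=; lra.
  have [e2|n2] := eqVneq m.+1 r.
    by have := z0 m; have := z0 m.+1; rewrite /=; lra.
  rewrite /z n1 n2 /= !addr0; apply: (le_trans (chy m n1)).
  by have := sqr_ge0 ((y m.+1 - c) + (y m - c)); nra.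
have e1 : (r < m.+1)%N%:R = (r < m)%N%:R + (m == r)%:R :> R.
  by rewrite ltnS -natrD; congr (_%:R); case: ltngtP.
have e2 : (r <= m.+1)%N%:R = (r <= m)%N%:R + (m.+1 == r)%:R :> R.
  rewrite -natrD; congr (_%:R); rewrite leq_eqVlt ltnS [r == _]eq_sym.
  by case: eqP => [<-|_]; rewrite ?ltnn ?addn0.
by rewrite e1 e2; lra.
Qed.

(** D_n / N is the sum of squares about the mean of the retained regressors. The loss 3 consists of
    the two changes next to the omitted index and the last change, whose endpoint y_n is not a
    regressor. *)
Lemma Dn_ge_changes r n y (ch : nat -> R) : (r < n)%N -> 1 < n%:R :> R ->
  (forall i, 0 <= ch i <= 1) ->
  (forall i, i != r -> ch i <= (y i.+1 - y i) ^+ 2) ->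
  \sum_(i < n) ch i - 3 <= 4 * (Dn r.+1 n y / (n%:R - 1)).
Proof.
move=> rn n1 ch01 chy.
have N0 : n%:R - 1 != 0 :> R by rewrite gt_eqF// subr_gt0.
pose c := sum_s r.+1 n (fun k => y k.-1) / (n%:R - 1).
pose z i := if i != r then (y i - c) ^+ 2 else 0.
have z0 i : 0 <= z i by rewrite /z; case: ifP => // _; exact: sqr_ge0.
have -> : Dn r.+1 n y / (n%:R - 1) = \sum_(i < n) z i.
  transitivity (sum_s r.+1 n (fun k => (y k.-1 - c) ^+ 2)).
    by rewrite sum_centered_sq//= /Dn /c; field.
  by rewrite sum_sE big_mkcond.
case: n rn n1 {N0} @c @z z0 => [//|m] rn n1 c z z0.
have h : \sum_(i < m) ch i <= 4 * (\sum_(i < m.+1) z i) - 2 * z m +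
    (r < m)%N%:R + (r <= m)%N%:R by exact: (sum_changes_le r y c ch m ch01 chy).
rewrite [X in X - _]big_ord_recr /=.
have /andP[_ c1] := ch01 m.
have r1 : (r < m)%N%:R <= 1 :> R by rewrite lern1 leq_b1.
have r2 : (r <= m)%N%:R <= 1 :> R by rewrite lern1 leq_b1.
have := z0 m; lra.
Qed.

End LeastSquares.

(** * Averages that vanish in the limit *)

Section Averages.
Context {R : realType}.
Implicit Types f g : nat -> R.

Definition average f n : R := (\sum_(i < n) f i) / n%:R.

Lemma cvg0_le (u v : nat -> R) : (\forall n \near \oo, `|v n| <= u n) ->
  u @ \oo --> 0 -> v @ \oo --> 0.
Proof.
move=> vu /cvgr0Pnorm_lt u0; apply/cvgr0Pnorm_lt => e e0.
near=> n; have vn : `|v n| <= u n by near: n.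
by apply: (le_lt_trans (le_trans vn (ler_norm _))); near: n; exact: u0.
Unshelve. all: by end_near. Qed.

Lemma cvg_divn0 (c : R) : (fun n => c / n%:R) @ \oo --> 0.
Proof.
apply/cvgr0Pnorm_lt => e e0; near=> n.
have n0 : (0 < n)%N by near: n; exact: nbhs_infty_gt.
rewrite normrM normfV normr_nat ltr_pdivrMr ?ltr0n//.
rewrite mulrC -ltr_pdivrMr//.
by near: n; exact: nbhs_infty_gtr.
Unshelve. all: by end_near. Qed.

Lemma average_eventually f g : (\forall k \near \oo, f k = g k) ->
  average g @ \oo --> 0 -> average f @ \oo --> 0.
Proof.
move=> [M _ fg] g0.
pose c := \sum_(i < M) (f i - g i).
have E n : (M <= n)%N -> \sum_(i < n) f i = \sum_(i < n) g i + c.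
  move=> /subnKC <-; elim: (n - M)%N => [|j ih].
    by rewrite addn0 /c -big_split /=; apply: eq_bigr => i _; rewrite addrC subrK.
  by rewrite addnS !big_ord_recr /= ih fg /= ?leq_addr// addrAC.
apply: (@cvg_trans _ ((fun n => average g n + c / n%:R) @ \oo)).
  apply: near_eq_cvg; near=> n; rewrite /average E ?mulrDl//.
  by near: n; exact: nbhs_infty_ge.
by have := cvgD g0 (cvg_divn0 c); rewrite addr0; exact.
Unshelve. all: by end_near. Qed.

Lemma average_omit r f : average f @ \oo --> 0 ->
  (fun n => (\sum_(i < n | i != r :> nat) f i) / n%:R) @ \oo --> 0.
Proof.
move=> f0; under eq_fun do rewrite big_mkcond/=.
apply: (average_eventually (fun i => if i != r then f i else 0) f _ f0).
near=> k; rewrite ifT// gtn_eqF//.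
by near: k; exact: nbhs_infty_gt.
Unshelve. all: by end_near. Qed.

End Averages.

(** * Convergence of the estimators on a path satisfying the limit laws *)

Section Consistency.
Context {R : realType}.
Variables (alpha mu theta delta : R) (r : nat) (y e ch g : nat -> R).
Hypothesis alpha01 : 0 < alpha < 1.
Hypothesis delta_gt0 : 0 < delta.
Hypothesis theta_ge0 : 0 <= theta.
Hypothesis mu_ge0 : 0 <= mu.
Hypothesis y_ge0 : forall k, 0 <= y k.
Hypothesis y_rec : forall k, y k.+1 = alpha * y k + mu + e k + (k == r)%:R * theta.
Hypothesis e_avg : average e @ \oo --> 0.
Hypothesis ye_avg : average (fun k => y k * e k) @ \oo --> 0.
Hypothesis ch01 : forall k, 0 <= ch k <= 1.
Hypothesis ch_le : forall k, k != r -> ch k <= (y k.+1 - y k) ^+ 2.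
Hypothesis ch_avg : average (fun k => ch k - g k) @ \oo --> 0.
Hypothesis g_ge : forall k, delta <= g k.
Local Notation s := r.+1.

(** Eventually the average noise is below 1, so the summed recursion gives (1 - alpha) sum y <= (y_0
    + mu + 1 + theta) n; the factor 2 covers n <= 2 (n - 1). *)
Let A := 2 * (y 0%N + mu + 1 + theta) / (1 - alpha).

(** Eventually the changes add up to at least delta n / 2, and the loss 3 is below delta n / 4 once
    n > 12 / delta. Dividing the remaining delta n / 4 by 4 gives 16. *)
Lemma Dn_linear_growth : \forall n \near \oo,
  delta * n%:R / 16 <= Dn s n y / (n%:R - 1).
Proof.
move/cvgr0Pnorm_lt : ch_avg => /(_ (delta / 2)) cha.
have d20 : 0 < delta / 2 by rewrite divr_gt0.
near=> n.
have n1 : 1 < n%:R :> R by near: n; exact: nbhs_infty_gtr.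
have rn : (r < n)%N by near: n; exact: nbhs_infty_gt.
have n12 : 12 / delta < n%:R by near: n; exact: nbhs_infty_gtr.
have n0 : 0 < n%:R :> R by lra.
have := Dn_ge_changes r n y ch rn n1 ch01 ch_le.
have : `|average (fun k => ch k - g k) n| < delta / 2 by near: n; exact: cha.
rewrite /average normrM normfV normr_nat ltr_pdivrMr// sumrB ltr_norml => /andP[lo _].
have gs : delta * n%:R <= \sum_(i < n) g i.
  rewrite mulr_natr -[X in _ *+ X](card_ord n) -sumr_const.
  by apply: ler_sum => i _; exact: g_ge.
have dn : 12 < delta * n%:R by rewrite mulrC -ltr_pdivrMr.
lra.
Unshelve. all: by end_near. Qed.

(** The recursion is summed and telescoped. Since y_n is non-negative, this bounds the path sum
    linearly without knowledge of its limit. *)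
Lemma sum_path_le n :
  (1 - alpha) * (\sum_(i < n) y i) + y n =
  y 0%N + mu * n%:R + \sum_(i < n) e i + (r < n)%N%:R * theta.
Proof.
elim: n => [|n ih]; first by rewrite !big_ord0 !mulr0 ltn0 mul0r; ring.
rewrite !big_ord_recr /= y_rec -natr1.
have -> : (r < n.+1)%N%:R = (r < n)%N%:R + (n == r)%:R :> R.
  by rewrite ltnS -natrD; congr (_%:R); case: ltngtP.
rewrite mulrDr; move: ih; lra.
Qed.

Lemma mean_regressor_bounded : \forall n \near \oo,
  0 <= sum_s s n (fun k => y k.-1) <= A * (n%:R - 1).
Proof.
move/cvgr0Pnorm_lt : e_avg => /(_ 1 ltr01) ea.
near=> n.
have n2 : 2 < n%:R :> R by near: n; exact: nbhs_infty_gtr.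
have n0 : 0 < n%:R :> R by lra.
rewrite sum_sE /=; apply/andP; split; first by rewrite sumr_ge0.
have le1 : \sum_(i < n | i != r :> nat) y i <= \sum_(i < n) y i.
  rewrite big_mkcond/=; apply: ler_sum => i _; by case: ifP.
apply: (le_trans le1).
have : `|average e n| < 1 by near: n; exact: ea.
rewrite /average normrM normfV normr_nat ltr_pdivrMr// mul1r ltr_norml => /andP[_ hi].
have := sum_path_le n; have := y_ge0 n; have := y_ge0 0%N => y0 yn sp.
move: alpha01 => /andP[a0 a1].
have th : (r < n)%N%:R * theta <= theta by case: (r < n)%N; rewrite ?mul1r ?mul0r.
rewrite /A mulrAC ler_pdivlMr; last by lra.
rewrite mulrC.
have : (y 0%N + theta) * n%:R >= y 0%N + theta.
  by rewrite ler_peMr ?addr_ge0//; lra.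
have : 0 <= (y 0%N + mu + 1 + theta) * (n%:R - 2).
  by apply: mulr_ge0; [rewrite !addr_ge0|lra].
have : 0 <= (y 0%N + theta) * (n%:R - 2) by apply: mulr_ge0; [rewrite addr_ge0|lra].
lra.
Unshelve. all: by end_near. Qed.

Lemma sum_response n : (1 <= s <= n)%N ->
  sum_s s n y = alpha * sum_s s n (fun k => y k.-1) + mu * (n%:R - 1) +
    \sum_(i < n | i != r :> nat) e i.
Proof.
move=> rn; rewrite -(sum_s1 s n rn) -!sum_sZ -(sum_sE r n (fun k => e k.-1)) -!sum_sD.
apply: eq_sum_s => -[//|k] _ /= ks.
by rewrite y_rec -eqSS (negbTE ks) mul0r addr0 mulr1.
Qed.

Lemma alpha_hat_cvg : (fun n => alpha_hat s n y) @ \oo --> alpha.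
Proof.
apply/subr_cvg0.
have y0 := y_ge0 0%N.
move: (alpha01) => /andP[a0 a1].
have A0 : 0 <= A by apply: divr_ge0; [rewrite mulr_ge0 ?addr_ge0|lra].
pose E0 n := (\sum_(i < n | i != r :> nat) e i) / n%:R.
pose E1 n := (\sum_(i < n | i != r :> nat) y i * e i) / n%:R.
(* This dominates the error: D_n / N >= delta n / 16 bounds the denominator, and [A] bounds the mean
   regressor that multiplies [E0]. *)
have bound0 : (fun n => 16 / delta * (`|E1 n| + A * `|E0 n|)) @ \oo --> 0.
  have E00 : (fun n => `|E0 n|) @ \oo --> 0.
    by apply/norm_cvg0P; exact: average_omit.
  have E10 : (fun n => `|E1 n|) @ \oo --> 0.
    by apply/norm_cvg0P; exact: (average_omit r (fun i => y i * e i)).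
  have := cvgM (cvg_cst (16 / delta)) (cvgD E10 (cvgM (cvg_cst A) E00)).
  by rewrite mulr0 addr0 mulr0; exact.
apply: cvg0_le bound0.
near=> n.
have DN : delta * n%:R / 16 <= Dn s n y / (n%:R - 1).
  by near: n; exact: Dn_linear_growth.
have /andP[S0 SA] : 0 <= sum_s s n (fun k => y k.-1) <= A * (n%:R - 1).
  by near: n; exact: mean_regressor_bounded.
have n1 : 1 < n%:R :> R by near: n; exact: nbhs_infty_gtr.
have rn : (1 <= s <= n)%N by rewrite /=; near: n; exact: nbhs_infty_gt.
have N0 : 0 < n%:R - 1 :> R by rewrite subr_gt0.
have n0 : 0 < n%:R :> R by lra.
have q0 : 0 < delta * n%:R / 16 by rewrite divr_gt0// mulr_gt0.
have D0 : 0 < Dn s n y / (n%:R - 1) by exact: lt_le_trans q0 DN.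
have Dpos : 0 < Dn s n y by rewrite -(pmulr_lgt0 _ (_ : 0 < (n%:R - 1)^-1)) ?invr_gt0.
set S1 := sum_s s n (fun k => y k.-1) in S0 SA.
have S0e : sum_s s n y = alpha * S1 + mu * (n%:R - 1) + n%:R * E0 n.
  by rewrite sum_response// /E0 mulrCA divff ?gt_eqF// mulr1.
have S01e : sum_s s n (fun k => y k.-1 * y k) =
    alpha * sum_s s n (fun k => y k.-1 ^+ 2) + mu * S1 + n%:R * E1 n.
  rewrite /E1 mulrCA divff ?gt_eqF// mulr1 -!sum_sZ.
  rewrite -(sum_sE r n (fun k => y k.-1 * e k.-1)) -!sum_sD; apply: eq_sum_s => -[//|k] _ /= ks.
  by rewrite y_rec -eqSS (negbTE ks) mul0r addr0; ring.
have -> : alpha_hat s n y - alpha =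
    n%:R * (E1 n - S1 / (n%:R - 1) * E0 n) / (Dn s n y / (n%:R - 1)).
  move: Dpos; rewrite /alpha_hat S0e S01e /Dn -/S1 => Dpos.
  by field; rewrite !gt_eqF.
rewrite normrM [`|_^-1|]gtr0_norm ?invr_gt0// ler_pdivrMr//.
have h0 : 0 <= 16 / delta * (`|E1 n| + A * `|E0 n|).
  apply: mulr_ge0; first by apply: divr_ge0 => //; exact: ltW.
  by apply: addr_ge0 => //; exact: mulr_ge0.
apply: le_trans (ler_wpM2l h0 DN).
rewrite [leRHS](_ : _ = n%:R * (`|E1 n| + A * `|E0 n|)); last by field; rewrite gt_eqF.
rewrite normrM gtr0_norm// ler_pM2l//.
apply: (le_trans (ler_normB _ _)); rewrite lerD2l normrM.
have S1N0 : 0 <= S1 / (n%:R - 1) by rewrite divr_ge0// ltW.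
rewrite ler_wpM2r// ger0_norm//.
by rewrite ler_pdivrMr.
Unshelve. all: by end_near. Qed.

Lemma Dn_eventually_gt0 : \forall n \near \oo, 0 < Dn s n y /\ 1 < n%:R :> R.
Proof.
near=> n.
have DN : delta * n%:R / 16 <= Dn s n y / (n%:R - 1).
  by near: n; exact: Dn_linear_growth.
have n1 : 1 < n%:R :> R by near: n; exact: nbhs_infty_gtr.
split=> //; rewrite -(pmulr_lgt0 _ (_ : 0 < (n%:R - 1)^-1)) ?invr_gt0 ?subr_gt0//.
by apply: lt_le_trans DN; rewrite divr_gt0// mulr_gt0//; lra.
Unshelve. all: by end_near. Qed.

(** Dividing the intercept equation by N expresses this error through that of [alpha_hat], times the
    bounded mean regressor, and the average noise; 2 bounds n / (n - 1). *)
Lemma mu_hat_cvg : (fun n => mu_hat s n y) @ \oo --> mu.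
Proof.
apply/subr_cvg0.
have y0 := y_ge0 0%N.
move: (alpha01) => /andP[a0 a1].
pose E0 n := (\sum_(i < n | i != r :> nat) e i) / n%:R.
have bound0 : (fun n => A * `|alpha_hat s n y - alpha| + 2 * `|E0 n|) @ \oo --> 0.
  have E00 : (fun n => `|E0 n|) @ \oo --> 0.
    by apply/norm_cvg0P; exact: average_omit.
  have a00 : (fun n => `|alpha_hat s n y - alpha|) @ \oo --> 0.
    by apply/norm_cvg0P; apply/subr_cvg0; exact: alpha_hat_cvg.
  have := cvgD (cvgM (cvg_cst A) a00) (cvgM (cvg_cst (2 : R)) E00).
  by rewrite !mulr0 addr0; exact.
apply: cvg0_le bound0.
near=> n.
have /andP[S0 SA] : 0 <= sum_s s n (fun k => y k.-1) <= A * (n%:R - 1).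
  by near: n; exact: mean_regressor_bounded.
have [Dpos _] : 0 < Dn s n y /\ 1 < n%:R :> R by near: n; exact: Dn_eventually_gt0.
have n2 : 2 < n%:R :> R by near: n; exact: nbhs_infty_gtr.
have rn : (1 <= s <= n)%N by rewrite /=; near: n; exact: nbhs_infty_gt.
have N0 : 0 < n%:R - 1 :> R by lra.
have n0 : 0 < n%:R :> R by lra.
have := normal_equation_intercept s n y; rewrite gt_eqF// => /(_ isT).
set S1 := sum_s s n (fun k => y k.-1) in S0 SA *.
have -> : sum_s s n y = alpha * S1 + mu * (n%:R - 1) + n%:R * E0 n.
  by rewrite sum_response// /E0 mulrCA divff ?gt_eqF// mulr1.
move=> eqn.
have -> : mu_hat s n y - mu =
    - (S1 / (n%:R - 1) * (alpha_hat s n y - alpha)) + n%:R / (n%:R - 1) * E0 n.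
  apply: (mulIf (_ : n%:R - 1 != 0)); first by rewrite gt_eqF.
  transitivity (alpha * S1 + n%:R * E0 n - alpha_hat s n y * S1); first by lra.
  by field; rewrite gt_eqF.
apply: (le_trans (ler_normD _ _)); rewrite normrN !normrM lerD//.
  have S1N0 : 0 <= S1 / (n%:R - 1) by rewrite divr_ge0// ltW.
  by rewrite -normrM ler_wpM2r// ger0_norm// ler_pdivrMr.
rewrite -normrM ler_wpM2r// gtr0_norm ?divr_gt0// ler_pdivrMr//; lra.
Unshelve. all: by end_near. Qed.

(** By the recursion the limit equals theta + [e r]: a single residual carries theta, so further
    data do not average out its innovation. *)
Lemma theta_hat_cvg :
  (fun n => theta_hat s n y) @ \oo --> y s - alpha * y s.-1 - mu.
Proof.
apply: cvgB; last exact: mu_hat_cvg.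
apply: cvgB; first exact: cvg_cst.
by apply: cvgM; [exact: alpha_hat_cvg|exact: cvg_cst].
Qed.

End Consistency.

Theorem theorem4p3p1 (d : measure_display) (T : measurableType d) (R : realType)
  (P : probability T R) (alpha : R) (s theta : nat)
  (Y0 : T -> nat) (eps : nat -> T -> nat) (xi : nat -> nat -> T -> nat) :
  0 < alpha < 1 -> (1 <= s)%N -> (1 <= theta)%N ->
  (* measurability of the primitive (discrete) random variables *)
  (forall i m, measurable (inar_family Y0 eps xi i @^-1` [set m])) ->
  (* Y0, the eps_k and the xi_{k,j} are all mutually independent *)
  mutually_independent P (inar_family Y0 eps xi) ->
  (* eps_k identically distributed *)
  (forall k m, P (eps k @^-1` [set m]) = P (eps 0%N @^-1` [set m])) ->
  (* E eps_1^2 < oo and P(eps_1 <> 0) > 0 *)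
  P.-integrable setT (fun w => (((eps 0%N w)%:R : R) ^+ 2)%:E) ->
  (0 < P (eps 0%N @^-1` [set m | m != 0%N]))%E ->
  (* xi_{k,j} ~ Bernoulli(alpha) *)
  (forall k j, P (xi k j @^-1` [set 1%N]) = alpha%:E /\
               P (xi k j @^-1` [set 0%N]) = (1 - alpha)%:E) ->
  (* E Y0^2 < oo *)
  P.-integrable setT (fun w => (((Y0 w)%:R : R) ^+ 2)%:E) ->
  let Y := fun w k => ((inar_Y s theta Y0 eps xi k w)%:R : R) in
  let mu := ('E_P[fun w => ((eps 0%N w)%:R : R)])%E in
  {ae P, forall w,
    (exists n0 : nat, forall n : nat, (n0 <= n)%N -> (s <= n)%N ->
       forall a m t : R,
         (a, m, t) <> (alpha_hat s n (Y w), mu_hat s n (Y w), theta_hat s n (Y w)) ->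
         Qn s n (Y w) (alpha_hat s n (Y w)) (mu_hat s n (Y w)) (theta_hat s n (Y w))
         < Qn s n (Y w) a m t)
    /\ ((fun n => alpha_hat s n (Y w)) @ \oo --> alpha)
    /\ ((fun n => mu_hat s n (Y w)) @ \oo --> fine mu)
    /\ ((fun n => theta_hat s n (Y w)) @ \oo
          --> Y w s - alpha * Y w s.-1 - fine mu)}.
Proof.
move=> alpha01; case: s => [//|r] _ _.
move=> mfam indfam eps_law eps_sq eps_pos xi_law Y0_sq Y mu.
have [delta delta0 chd] := change_prob_gt0 P alpha Y0 eps xi alpha01 mfam indfam
  eps_law xi_law eps_pos.
have Hch := ae_average_change P alpha r.+1 theta Y0 eps xi alpha01 mfam indfam
  eps_law eps_sq xi_law Y0_sq.
have Hin := ae_average_innovation P alpha r.+1 theta Y0 eps xi alpha01 mfam indfam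
  eps_law eps_sq xi_law Y0_sq.
have Htr := ae_average_truncated P alpha r.+1 theta Y0 eps xi alpha01 mfam indfam
  eps_law eps_sq xi_law Y0_sq.
have Hle := ae_eventually_le_truncation P alpha r.+1 theta Y0 eps xi alpha01 mfam indfam
  eps_law eps_sq xi_law Y0_sq.
have muE : fine mu = eps_mean P eps by rewrite /mu unlock.
(* On the intersection of these four almost sure events everything that remains is deterministic. *)
apply: filterS (filterI (filterI Hch Hin) (filterI Htr Hle)) => w [[ch_avg e_avg] [tr_avg Yle]].
pose next k := transition eps xi k (inar_Y r.+1 theta Y0 eps xi k w) w.
pose e k : R := innovation P alpha eps (inar_Y r.+1 theta Y0 eps xi k w) (next k).
pose ch k : R := (next k != inar_Y r.+1 theta Y0 eps xi k w)%:R.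
pose g k : R := change_prob P eps xi k (inar_Y r.+1 theta Y0 eps xi k w).
have y0 k : 0 <= Y w k by rewrite /Y.
have theta0 : 0 <= theta%:R :> R by [].
have mu0 := eps_mean_ge0 P eps.
have rec k : Y w k.+1 = alpha * Y w k + eps_mean P eps + e k + (k == r)%:R * theta%:R.
  rewrite /Y inar_YS -/(next k) natrD /shift eqSS natrM /e /innovation.
  by ring.
(* The truncation is eventually inactive along this path, so the untruncated averages have the same
   limit. *)
have ye_avg : average (fun k => Y w k * e k) @ \oo --> 0.
  apply: (average_eventually _ (fun k => (Y w k <= truncation k)%R%:R * Y w k * e k) _ tr_avg).
  by apply: filterS Yle => k Yk; rewrite Yk mul1r.
have ch01 k : 0 <= ch k <= 1 by rewrite /ch ler0n lern1 leq_b1.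
(* Away from the outlier step a change of state is a difference of distinct integers, hence at least
   1 in absolute value; at the outlier step theta could compensate for it. *)
have ch_le k : k != r -> ch k <= (Y w k.+1 - Y w k) ^+ 2.
  move=> kr; rewrite /Y inar_YS -/(next k) /shift eqSS (negbTE kr) mul0n addn0 /ch.
  case: eqP => [_|/eqP ne]; first exact: sqr_ge0.
  apply: (@le_trans _ _ 1) => //.
  by move: ne; rewrite neq_ltn => /orP[]; rewrite -(ler_nat R) -natr1 => h; nra.
have gd k : delta <= g k by exact: chd.
split.
  have [n0 _ Hn0] := Dn_eventually_gt0 delta r (Y w) ch g delta0 ch01 ch_le ch_avg gd.
  exists n0 => n nn0 sn a m t.
  have [Dpos n1] := Hn0 n nn0.
  exact: Qn_lt_minimizer.
rewrite muE; split; [|split].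
- exact: (alpha_hat_cvg alpha (eps_mean P eps) theta%:R delta r (Y w) e ch g).
- exact: (mu_hat_cvg alpha (eps_mean P eps) theta%:R delta r (Y w) e ch g).
- exact: (theta_hat_cvg alpha (eps_mean P eps) theta%:R delta r (Y w) e ch g).
Qed.
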